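(* In three spacetime dimensions, at curvature order $n$ there are $\#(n)-n=\#(n-6)$ generalized quasi-topological densities. All of them are trivial and proportional to the single sextic density $\mathcal{Y}_{(6)}=6\mathcal{S}_3^2-\mathcal{S}_2^3$, which vanishes identically on the single-function static spherically symmetric ansatz: the generalized quasi-topological densities of order $n$ are $\mathcal{L}^{\rm GQT}_{(n)}=\mathcal{Y}_{(6)}\cdot\mathcal{L}^{\rm general}_{(n-6)}$, where $\mathcal{L}^{\rm general}_{(n-6)}$ is the most general density of order $n-6$. Hence there exist no non-trivial generalized quasi-topological densities in three dimensions.
   Context: Let $R_{ab}$ and $R$ be the Ricci tensor and scalar of a three-dimensional metric $g_{ab}$, $R_{\langle ab\rangle}=R_{ab}-\frac13 g_{ab}R$, $\mathcal{S}_2=R_{\langle a}{}^{b\rangle}R_{\langle b}{}^{a\rangle}$ and $\mathcal{S}_3=R_{\langle a}{}^{b\rangle}R_{\langle b}{}^{c\rangle}R_{\langle c}{}^{a\rangle}$. In three dimensions every order-$n$ density built from the Riemann tensor and the metric is a linear combination of the monomials $R^i\mathcal{S}_2^j\mathcal{S}_3^k$ with $i+2j+3k=n$; $\#(n)$ denotes the number of independent order-$n$ densities, $\#(n)=\frac{1}{72}\left[47+9(-1)^n+6n(6+n)+16\cos\left(\frac{2\pi n}{3}\right)\right]$. The single-function static spherically symmetric ansatz is $ds^2=-f(r)\,dt^2+\frac{dr^2}{f(r)}+r^2d\theta^2$, with $f$ an arbitrary function; $\mathcal{L}|_f$ denotes the evaluation of a density $\mathcal{L}$ on it, and $L_f=r\,\mathcal{L}|_f$.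 The density $\mathcal{L}$ is generalized quasi-topological if the Euler-Lagrange equation of $L_f$ vanishes identically, $\frac{\partial L_f}{\partial f}-\frac{d}{dr}\frac{\partial L_f}{\partial f'}+\frac{d^2}{dr^2}\frac{\partial L_f}{\partial f''}-\dots=0$ for all $f$. It is called trivial if it makes no contribution to the equation determining $f$ (the equation obtained by evaluating the action on $ds^2=-N(r)^2f\,dt^2+dr^2/f+r^2d\theta^2$, varying with respect to $N$ and setting $N=1$).
   Formalization: The curvature order is restricted to n ≥ 2: at n = 1 the density R is generalized quasi-topological although #(1)−1 = 0, and at n = 0 the constant density is generalized quasi-topological but not trivial. *)

(* Defs.v *)
From HB Require Import structures.
From mathcomp Require Import all_boot all_order all_algebra.
From mathcomp Require Import all_classical all_reals all_analysis.
Set Implicit Arguments.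
Unset Strict Implicit.
Unset Printing Implicit Defensive.
Import Order.TTheory GRing.Theory Num.Theory.
Import numFieldNormedType.Exports.
Local Open Scope classical_set_scope.
Local Open Scope ring_scope.

Section Geometry.
Variable R : realType.

(* Coordinates (x 0 0, x 0 1, x 0 2) = (t, r, theta). *)
Definition coords : Type := 'rV[R]_3.
Definition metric : Type := 'rV[R]_3 -> 'M[R]_3.

Definition partial (i : 'I_3) (F : 'rV[R]_3 -> R) (x : 'rV[R]_3) : R :=
  'D_(delta_mx 0 i) F x.

(* Gamma^a_{bc} *)
Definition christoffel (g : metric) (a b c : 'I_3) (x : 'rV[R]_3) : R :=
  2^-1 * \sum_d invmx (g x) a d *
    (partial b (fun y => g y d c) x + partial c (fun y => g y d b) x
     - partial d (fun y => g y b c) x).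

(* R^a_{bcd} = d_c Gamma^a_{db} - d_d Gamma^a_{cb}
               + Gamma^a_{ce} Gamma^e_{db} - Gamma^a_{de} Gamma^e_{cb} *)
Definition riemann (g : metric) (a b c d : 'I_3) (x : 'rV[R]_3) : R :=
  partial c (christoffel g a d b) x - partial d (christoffel g a c b) x
  + \sum_e (christoffel g a c e x * christoffel g e d b x
            - christoffel g a d e x * christoffel g e c b x).

Definition ricci (g : metric) (x : 'rV[R]_3) : 'M[R]_3 :=
  \matrix_(b, d) \sum_a riemann g a b a d x.

(* A scalar density is a functional of the metric, evaluated at a point;
   the volume factor sqrt |det g| is not included. *)
Definition density : Type := metric -> coords -> R.

Definition scalarR : density := fun g x => \tr (ricci g x *m invmx (g x)).

(* The mixed components R_<a>^<b> of the traceless Ricci tensor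
   R_<ab> = R_ab - R g_ab / 3. *)
Definition tracelessRicci (g : metric) (x : 'rV[R]_3) : 'M[R]_3 :=
  (ricci g x - (scalarR g x / 3) *: g x) *m invmx (g x).

Definition scalarS2 : density := fun g x => \tr (tracelessRicci g x ^+ 2).
Definition scalarS3 : density := fun g x => \tr (tracelessRicci g x ^+ 3).

Definition densityY6 : density :=
  fun g x => 6 * scalarS3 g x ^+ 2 - scalarS2 g x ^+ 3.

Definition lspan (A : set density) : set density :=
  [set L | exists (k : nat) (c : 'I_k -> R) (e : 'I_k -> density),
     (forall i, A (e i)) /\ L = (fun g x => \sum_i c i * e i g x)].

(* Curvature order m; it is an integer so that "order n - 6" makes sense when
   n < 6, the only density of negative order being 0. *)
Definition curvature_monomials (m : int) : set density :=
  [set L | exists i j k : nat, (i + 2 * j + 3 * k)%N%:Z = m /\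
     L = (fun g x => scalarR g x ^+ i * scalarS2 g x ^+ j * scalarS3 g x ^+ k)].

Definition order_densities (m : int) : set density :=
  lspan (curvature_monomials m).

(* g is a smooth metric of signature (-, +, +) in a neighbourhood of x *)
Definition lorentz_form (G : 'M[R]_3) : Prop :=
  exists2 P : 'M[R]_3, P \in unitmx &
    P *m G *m P^T = diag_mx (\row_(i < 3) [:: -1; 1; 1]`_i).

Definition lorentzian_near (g : metric) (x : 'rV[R]_3) : Prop :=
  \forall y \near x, lorentz_form (g y) /\
    forall (a b : 'I_3) (s : seq 'I_3),
      differentiable (foldr partial (fun z => g z a b) s) y.

(* A is a space of densities containing exactly d independent ones. Linear
   independence is that of functionals on Lorentzian metrics. *)
Definition independent_number (A : set density) (d : nat) : Prop :=
  exists e : 'I_d -> density,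
    [/\ A = lspan (range e) &
        forall c : 'I_d -> R,
          (forall g x, lorentzian_near g x -> \sum_i c i * e i g x = 0) ->
          forall i, c i = 0].

Definition sharp (m : int) : R :=
  (47 + 9 * (-1) ^ m + 6 * m%:~R * (6 + m%:~R)
   + 16 * cos (2 * pi * m%:~R / 3)) / 72.

(* ds^2 = - N(r)^2 f(r) dt^2 + dr^2 / f(r) + r^2 dtheta^2 *)
Definition metricNf (N f : R -> R) : metric := fun x =>
  let r := x 0 1 in
  diag_mx (\row_(i < 3) [:: - (N r ^+ 2 * f r); (f r)^-1; r ^+ 2]`_i).

Definition metricf (f : R -> R) : metric := metricNf (fun=> 1) f.

(* The metrics above do not depend on t and theta, so their curvature
   invariants can be evaluated at t = theta = 0. *)
Definition radial_point (r : R) : coords :=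
  \row_(i < 3) [:: 0; r; 0]`_i.

Definition smooth_pos (f : R -> R) : Prop :=
  forall (k : nat) (r : R), 0 < r -> derivable (derive1n k f) r 1.

(* If (F u)(r) depends on u only through the k-jet
   (u(r), u'(r), ..., u^(k)(r)), then jet_function k F r is the corresponding
   function of the jet (y_0, ..., y_k): the value of F on the Taylor polynomial
   having this jet at r. *)
Definition jet_function (k : nat) (F : (R -> R) -> R -> R) (r : R)
    (y : nat -> R) : R :=
  F (fun s => \sum_(i < k.+1) y i * (s - r) ^+ i / i`!%:R) r.

(* \sum_(i <= k) (-1)^i (d/dr)^i (d F / d u^(i)), evaluated along u at r *)
Definition euler_lagrange (k : nat) (F : (R -> R) -> R -> R) (u : R -> R)
    (r : R) : R :=
  \sum_(i < k.+1) (-1) ^+ i *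
    derive1n i (fun s : R =>
      derive1 (fun v : R =>
        jet_function k F s (fun j => if j == i then v else derive1n j u s))
        (derive1n i u s)) r.

Definition reduced_lagrangian (L : density) (f : R -> R) (r : R) : R :=
  r * L (metricf f) (radial_point r).

(* Curvature scalars involve two derivatives of the metric, so the reduced
   Lagrangians are of second order in f (and in N). The condition f r != 0
   excludes the coordinate singularities of the ansatz. *)
Definition gqt (L : density) : Prop :=
  forall (f : R -> R) (r : R), smooth_pos f -> 0 < r -> f r != 0 ->
    euler_lagrange 2 (reduced_lagrangian L) f r = 0.

Definition gqt_densities (m : int) : set density :=
  [set L | order_densities m L /\ gqt L].

Definition action_lagrangian (L : density) (f N : R -> R) (r : R) : R :=
  let x := radial_point r in
  Num.sqrt `|\det (metricNf N f x)| * L (metricNf N f) x.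

(* The equation for f obtained by varying N and setting N = 1 gets no
   contribution from L. *)
Definition trivial_density (L : density) : Prop :=
  forall (f : R -> R) (r : R), smooth_pos f -> 0 < r -> f r != 0 ->
    euler_lagrange 2 (action_lagrangian L f) (fun=> 1) r = 0.

End Geometry.

Arguments densityY6 {R}.

(* Main.v *)
Require Import Defs.
From HB Require Import structures.
From mathcomp Require Import all_boot all_order all_algebra.
From mathcomp Require Import all_classical all_reals all_analysis.
From mathcomp Require Import ring lra zify.
Import Order.TTheory GRing.Theory Num.Theory.
Import numFieldNormedType.Exports.
Local Open Scope classical_set_scope.
Local Open Scope ring_scope.

(* The relation S_3^2 = (Y_(6) + S_2^3) / 6 turns the monomials of order n into
   the basis Y_(6)^q R^(n-6q-p) T_p (6q + p <= n, p <> 1), where T_p is the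
   monomial S_2^j S_3^e with 2j + 3e = p and e <= 1. On the single-function ansatz
   two eigenvalues of the Ricci tensor coincide, so S_2 = 6 a^2, S_3 = - 6 a^3 and
   Y_(6) = 0, and only the terms with q = 0 survive, as distinct monomials
   R^(n-p) a^p. Evaluating their Euler-Lagrange equation on f = r^k for all k >= 3
   gives a recurrence for their coefficients; as the monomial R^(n-1) a is missing,
   it has only the zero solution when n >= 2. Conversely Y_(6) is - 2 times the
   discriminant of the Ricci tensor, which vanishes to second order where two
   eigenvalues coincide, whence triviality. Linear independence is tested on the
   metrics - exp(Q_0(r)) dt^2 + dr^2 + exp(Q_2(r)) dtheta^2 with Q_0 and Q_2
   quadratic, whose Ricci eigenvalues at r = 0 are arbitrary. *)

Set Implicit Arguments.
Unset Strict Implicit.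

(** * Derivatives of real functions *)

Lemma derive1_near (R : realType) (f g : R -> R) (r : R) :
  (\forall s \near r, f s = g s) -> derive1 f r = derive1 g r.
Proof. by move=> fg; rewrite !derive1E; apply: near_eq_derive. Qed.

Lemma derive1n_near (R : realType) (n : nat) (f g : R -> R) (r : R) :
  (\forall s \near r, f s = g s) -> derive1n n f r = derive1n n g r.
Proof.
elim: n r => [|n IH] r fg; first by rewrite /derive1n /=; apply: nbhs_singleton fg.
rewrite !derive1nS; apply: derive1_near.
by move/near_join: fg; apply: filterS => s; apply: IH.
Qed.

Lemma is_derive_derive1 (R : realType) (f : R -> R) (r d : R) :
  is_derive r (1 : R) f d -> derive1 f r = d.
Proof. by move=> fd; rewrite derive1E; apply: derive_val. Qed.

Lemma derivable_is_derive1 (R : realType) (f : R -> R) (r : R) :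
  derivable f r 1 -> is_derive r (1 : R) f (derive1 f r).
Proof. by rewrite derive1E; apply: derivableP. Qed.

Section PointwiseDerivatives.
Variables (R : realType) (r : R).
Implicit Types (f g : R -> R) (a b : R).

(* Not a class, unlike [is_derive]: the premises of the rules below are left
   to [derive_tac] instead of being solved by instance search. *)
Definition derives f a : Prop := is_derive r (1 : R) f a.

Lemma is_derive1_cst a : derives (fun=> a) 0.
Proof. exact: is_derive_cst. Qed.

Lemma is_derive1_id : derives (fun s : R => s) 1.
Proof. exact: is_derive_id. Qed.

Lemma is_derive1D f g a b : derives f a -> derives g b ->
  derives (fun s => f s + g s) (a + b).
Proof. by move=> fa gb; apply: is_deriveD. Qed.

Lemma is_derive1N f a : derives f a -> derives (fun s => - f s) (- a).
Proof. by move=> fa; apply: is_deriveN. Qed.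

Lemma is_derive1M f g a b : derives f a -> derives g b ->
  derives (fun s => f s * g s) (f r * b + g r * a).
Proof. by move=> fa gb; apply: is_deriveM. Qed.

Lemma is_derive1X f a n : derives f a ->
  derives (fun s => f s ^+ n) (n%:R * f r ^+ n.-1 * a).
Proof.
move=> fa; have -> : (fun s => f s ^+ n) = f ^+ n.
  by apply: funext => s; elim: n => [|n IH]; rewrite ?expr0 // !exprS IH.
case: n => [|n]; last exact: is_deriveX.
by rewrite !mul0r expr0; exact: is_derive_cst.
Qed.

Lemma is_derive1V f a : f r != 0 -> derives f a ->
  derives (fun s => (f s)^-1) (- a / f r ^+ 2).
Proof.
rewrite /derives => f0 fa; apply: DeriveDef; first exact: derivableV.
by rewrite deriveV // derive_val /GRing.scale /=; field.
Qed.

Lemma is_derive1_eq f a b : derives f a -> a = b -> is_derive r (1 : R) f b.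
Proof. by move=> fa <-. Qed.

Lemma is_derive1_sum (I : Type) (s : seq I) (P : pred I) (f : I -> R -> R)
    (a : I -> R) : (forall i, derives (f i) (a i)) ->
  derives (fun x => \sum_(i <- s | P i) f i x) (\sum_(i <- s | P i) a i).
Proof.
move=> fa; elim: s => [|i s IH].
  under eq_fun do rewrite big_nil; rewrite big_nil; exact: is_derive1_cst.
under eq_fun do rewrite big_cons; rewrite big_cons.
by case: (P i) => //; apply: is_derive1D.
Qed.
End PointwiseDerivatives.

(** The derivative is left as an existential variable that the rules fill in; where a prescribed
    value is wanted, [is_derive1_eq] compares it afterwards. *)
Ltac derive_tac :=
  first [ eassumption
        | eapply is_derive1_cst | eapply is_derive1_id
        | eapply is_derive1N; derive_tac
        | eapply is_derive1D; [derive_tac | derive_tac]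
        | eapply is_derive1M; [derive_tac | derive_tac]
        | eapply is_derive1X; derive_tac
        | eapply is_derive1V; [try done | derive_tac]
        | idtac ].

Lemma near_neq0 (R : realType) (f : R -> R) (r : R) :
  derivable f r 1 -> f r != 0 -> \forall s \near r, f s != 0.
Proof.
move=> /derivable1_diffP/differentiable_continuous fc fr.
by apply: (fc [set y | y != 0]); apply: open_nbhs_nbhs; split => //; exact: open_neq.
Qed.

(** The two difference quotients are the same function of [t], so both sides are the same limit,
    existing or not. *)
Lemma derive_transport (R : realType) (V W : normedModType R)
    (f : V -> R) (g : W -> R) (a v : V) (b w : W) :
  (forall t : R, f (t *: v + a) - f a = g (t *: w + b) - g b) ->
  'D_v f a = 'D_w g b.
Proof.
move=> fg; rewrite /derive.
have -> : (fun t : R => t^-1 *: ((f \o shift a) (t *: v) - f a)) =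
    (fun t => t^-1 *: ((g \o shift b) (t *: w) - g b)).
  by apply: funext => t /=; rewrite fg.
by [].
Qed.

Lemma partial_radial (R : realType) (i : 'I_3) (h : R -> R) (x : 'rV[R]_3) :
  partial i (fun y => h (y 0 1)) x =
    if (i : nat) == 1%N then derive1 h (x 0 1) else 0.
Proof.
have coordE (t : R) : (t *: delta_mx 0 i + x) 0 1 =
    t * ((i : nat) == 1%N)%:R + x 0 1.
  by rewrite !mxE eqxx /= -val_eqE /= eq_sym.
(* The zero branch is written as the derivative of a constant, so that [derive_transport] serves
   both cases. *)
rewrite -[X in if _ then _ else X](@derive_cst R R R 0 0 1) /partial.
case: ifP => i1; rewrite ?derive1E; apply: derive_transport => t.
  by rewrite coordE i1 mulr1 [t *: 1]mulr1.
by rewrite coordE i1 mulr0 add0r !subrr.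
Qed.

(** * Curvature of diagonal metrics *)

Definition diag_metric (R : realType) (F : 'I_3 -> R -> R) : metric R :=
  fun x => diag_mx (\row_(i < 3) F i (x 0 1)).

Lemma invmx_diag (R : realType) (d : 'rV[R]_3) : (forall i, d 0 i != 0) ->
  invmx (diag_mx d) = diag_mx (\row_i (d 0 i)^-1).
Proof.
move=> d0.
have dK : diag_mx d *m diag_mx (\row_i (d 0 i)^-1) = 1%:M.
  rewrite mulmx_diag -diag_const_mx; congr diag_mx.
  by apply/rowP => i; rewrite !mxE mulfV.
by rewrite -[LHS]mulmx1 -dK mulmxA mulVmx ?mul1mx // (mulmx1_unit dK).1.
Qed.

(* [l i] stands for [(ln |F i|)' / 2], which keeps the connection and its
   derivative free of second derivatives of the metric. *)
Section DiagonalCurvature.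
Variables (R : realType) (F l : 'I_3 -> R -> R).
Implicit Types (a b c d : 'I_3) (s r : R).

(** An equality of functions on the whole space, in the shape that [partial_radial] needs to
    differentiate the symbols inside [riemann]. *)
Lemma christoffel_radial a b c : christoffel (diag_metric F) a b c =
  fun x => christoffel (diag_metric F) a b c (radial_point (x 0 1)).
Proof.
apply: funext => x; rewrite /christoffel; congr (_ * _); apply: eq_bigr => d _.
have E i p q (y : 'rV[R]_3) : partial i (fun y => diag_metric F y p q) y =
    partial i (fun y => diag_metric F y p q) (radial_point (y 0 1)).
  rewrite (partial_radial i (fun s => diag_mx (\row_(i < 3) F i s) p q)).
  rewrite (partial_radial i (fun s => diag_mx (\row_(i < 3) F i s) p q)).
  by rewrite !mxE.
by rewrite (E b d c) (E c d b) (E d b c) /diag_metric !mxE.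
Qed.

Definition connection a b c s : R :=
  ((b : nat) == 1%N)%:R * ((a : nat) == c)%:R * l a s
  + ((c : nat) == 1%N)%:R * ((a : nat) == b)%:R * l a s
  - ((a : nat) == 1%N)%:R * ((b : nat) == c)%:R * (F b s * l b s / F 1 s).

Lemma christoffel_diag a b c (x : 'rV[R]_3) :
  (forall i, F i (x 0 1) != 0) ->
  (forall i, derive1 (F i) (x 0 1) = 2 * F i (x 0 1) * l i (x 0 1)) ->
  christoffel (diag_metric F) a b c x = connection a b c (x 0 1).
Proof.
move=> F0 Fl.
have E i p q : partial i (fun y => diag_metric F y p q) x =
    ((i : nat) == 1%N)%:R * ((p : nat) == q)%:R * (2 * F p (x 0 1) * l p (x 0 1)).
  rewrite (partial_radial i (fun s => diag_mx (\row_(i < 3) F i s) p q)).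
  case: ifP => _; rewrite ?mul0r // mul1r.
  have -> : (fun s => diag_mx (\row_(i < 3) F i s) p q) =
      (if (p : nat) == q then F p else cst 0).
    apply: funext => s; rewrite !mxE val_eqE.
    by case: eqP => [->|_]; rewrite ?mulr1n ?mulr0n.
  by case: ifP => _; rewrite ?Fl ?mul1r ?derive1_cst ?mul0r.
rewrite /christoffel /connection (bigD1 a) //= big1 ?addr0 => [|d da]; last first.
  rewrite invmx_diag => [|i]; last by rewrite mxE.
  by rewrite !mxE eq_sym (negbTE da) mulr0n mul0r.
rewrite invmx_diag => [|i]; last by rewrite mxE.
rewrite !mxE eqxx mulr1n !E.
have := F0 a; have := F0 1.
have [a1|a1] := eqVneq (a : nat) 1%N; last by rewrite /= => F1 Fa; rewrite !mul0r !subr0; field.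
have -> : a = 1 by apply: val_inj.
by move=> /= *; field.
Qed.

(** The radial derivative of [connection]; the quotient [F b / F 1] has logarithmic derivative
    [2 * (l b - l 1)]. *)
Definition dconnection (dl : 'I_3 -> R) a b c r : R :=
  ((b : nat) == 1%N)%:R * ((a : nat) == c)%:R * dl a
  + ((c : nat) == 1%N)%:R * ((a : nat) == b)%:R * dl a
  - ((a : nat) == 1%N)%:R * ((b : nat) == c)%:R *
    (F b r / F 1 r * (2 * (l b r - l 1 r) * l b r + dl b)).

Variables (r : R) (dl : 'I_3 -> R).
Hypothesis F_neq0 : forall i, \forall s \near r, F i s != 0.
Hypothesis dF : forall i, \forall s \near r, is_derive s (1 : R) (F i) (2 * F i s * l i s).
Hypothesis dlP : forall i, is_derive r (1 : R) (l i) (dl i).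

Lemma derive1_connection a b c :
  is_derive r (1 : R) (connection a b c) (dconnection dl a b c r).
Proof.
have F1 : F 1 r != 0 by apply: nbhs_singleton (F_neq0 1).
have d1 : is_derive r (1 : R) (F 1) _ := nbhs_singleton (dF 1).
have db : is_derive r (1 : R) (F b) _ := nbhs_singleton (dF b).
have := dlP a; have := dlP b; have := dlP 1 => e1 eb ea.
rewrite /connection /dconnection; apply: is_derive1_eq; first by derive_tac.
by rewrite /=; field.
Qed.
End DiagonalCurvature.

Lemma ord3_ind (P : 'I_3 -> Prop) : P 0 -> P 1 -> P 2 -> forall i, P i.
Proof.
move=> P0 P1 P2 [[|[|[|i]]] //= i3].
- by have -> : Ordinal i3 = 0 by apply: val_inj.
- by have -> : Ordinal i3 = 1 by apply: val_inj.
- by have -> : Ordinal i3 = 2 by apply: val_inj.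
Qed.

Lemma sum_ord3 (R : nmodType) (f : 'I_3 -> R) : \sum_i f i = f 0 + f 1 + f 2.
Proof.
rewrite !big_ord_recl big_ord0 addr0 addrA.
by congr (_ + f _ + f _); apply: val_inj.
Qed.

Section DiagonalCurvature2.
Variables (R : realType) (F l : 'I_3 -> R -> R) (r : R) (dl : 'I_3 -> R).
Hypothesis F_neq0 : forall i, \forall s \near r, F i s != 0.
Hypothesis dF : forall i, \forall s \near r, is_derive s (1 : R) (F i) (2 * F i s * l i s).
Hypothesis dlP : forall i, is_derive r (1 : R) (l i) (dl i).
Variable x : 'rV[R]_3.
Hypothesis x1 : x 0 1 = r.

Let conn a b c := connection F l a b c r.
Let dconn a b c := dconnection F l dl a b c r.

(** The closed form is wanted near [r], not just at [r], because [riemann] differentiates it. *)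
Let christoffelE : \forall s \near r, forall a b c,
  christoffel (diag_metric F) a b c (radial_point s) = connection F l a b c s.
Proof.
have Fs : \forall s \near r, forall i, F i s != 0.
  have := F_neq0 0; have := F_neq0 1; have := F_neq0 2.
  by apply: filterS3 => s f2 f1 f0; apply: ord3_ind.
have dFs : \forall s \near r, forall i, derive1 (F i) s = 2 * F i s * l i s.
  have := dF 0; have := dF 1; have := dF 2.
  by apply: filterS3 => s f2 f1 f0; apply: ord3_ind; apply: is_derive_derive1.
apply: filterS2 Fs dFs => s Fs dFs a b c.
by rewrite (christoffel_diag (l := l)) !mxE.
Qed.

Lemma riemann_diag a b c d : riemann (diag_metric F) a b c d x =
  ((c : nat) == 1%N)%:R * dconn a d b - ((d : nat) == 1%N)%:R * dconn a c b
  + \sum_e (conn a c e * conn e d b - conn a d e * conn e c b).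
Proof.
have dE p a' b' c' : partial p (christoffel (diag_metric F) a' b' c') x =
    ((p : nat) == 1%N)%:R * dconn a' b' c'.
  rewrite christoffel_radial.
  rewrite (partial_radial p (fun s => christoffel (diag_metric F) a' b' c' (radial_point s))).
  rewrite x1; case: ifP => _; rewrite ?mul0r ?mul1r //.
  apply: is_derive_derive1; have := derive1_connection F_neq0 dF dlP a' b' c'.
  apply: near_eq_is_derive; apply: filterS christoffelE => s E.
  by rewrite E.
have cE a' b' c' : christoffel (diag_metric F) a' b' c' x = conn a' b' c'.
  by rewrite christoffel_radial x1; have /= := nbhs_singleton christoffelE; apply.
by rewrite /riemann !dE; congr (_ + _); apply: eq_bigr => e _; rewrite !cE.
Qed.

(** Minus the sectional curvatures of the coordinate planes. If [|F i| = h_i ^ 2], then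
    [l i = h_i' / h_i]; for [F 1 > 0], [sectional01] is the second derivative of [h_0] in proper
    radial length, divided by [h_0]. *)
Definition sectional01 := (dl 0 + l 0 r ^+ 2 - l 0 r * l 1 r) / F 1 r.
Definition sectional02 := l 0 r * l 2 r / F 1 r.
Definition sectional12 := (dl 2 + l 2 r ^+ 2 - l 1 r * l 2 r) / F 1 r.

Let ric : 'I_3 -> R := fun i => nth 0
  [:: - (sectional01 + sectional02); - (sectional01 + sectional12);
      - (sectional02 + sectional12)] i.

Let F0 i : F i r != 0. Proof. exact: nbhs_singleton (F_neq0 i). Qed.

Lemma ricci_diag : ricci (diag_metric F) x = diag_mx (\row_i (F i r * ric i)).
Proof.
have := F0 1; have := F0 0; have := F0 2 => f2 f0 f1.
apply/matrixP; apply: ord3_ind; apply: ord3_ind; rewrite !mxE sum_ord3 !riemann_diag;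
  rewrite !sum_ord3 /conn /dconn /connection /dconnection /ric /=;
  rewrite /sectional01 /sectional02 /sectional12 ?mulr0n ?mulr1n; field; rewrite ?f0 ?f1 ?f2 //.
Qed.

Let diag_metricE : diag_metric F x = diag_mx (\row_i F i r).
Proof. by rewrite /diag_metric x1. Qed.

Let invE : invmx (diag_metric F x) = diag_mx (\row_i (F i r)^-1).
Proof.
rewrite diag_metricE invmx_diag => [|i]; last by rewrite mxE.
by congr diag_mx; apply/rowP => i; rewrite !mxE.
Qed.

Lemma scalarR_diag : scalarR (diag_metric F) x =
  - 2 * (sectional01 + sectional02 + sectional12).
Proof.
rewrite /scalarR ricci_diag invE mulmx_diag mxtrace_diag sum_ord3 !mxE /ric /=.
by field; rewrite !F0.
Qed.

Let eigen : 'rV[R]_3 := \row_(i < 3) nth 0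
  [:: (2 * sectional12 - sectional01 - sectional02) / 3;
      (2 * sectional02 - sectional01 - sectional12) / 3;
      (2 * sectional01 - sectional02 - sectional12) / 3] i.

Lemma tracelessRicci_diag : tracelessRicci (diag_metric F) x = diag_mx eigen.
Proof.
rewrite /tracelessRicci scalarR_diag ricci_diag invE diag_metricE.
rewrite -linearZ -linearB /= mulmx_diag; congr diag_mx; apply/rowP.
by apply: ord3_ind; rewrite !mxE /ric /=; field; rewrite F0.
Qed.

Lemma scalarS2_diag : scalarS2 (diag_metric F) x = \sum_i eigen 0 i ^+ 2.
Proof.
rewrite /scalarS2 tracelessRicci_diag expr2 -mulmxE mulmx_diag mxtrace_diag.
by apply: eq_bigr => i _; rewrite mxE expr2.
Qed.

Lemma scalarS3_diag : scalarS3 (diag_metric F) x = \sum_i eigen 0 i ^+ 3.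
Proof.
rewrite /scalarS3 tracelessRicci_diag !exprS expr0 mulr1 -mulmxE !mulmx_diag.
by rewrite mxtrace_diag; apply: eq_bigr => i _; rewrite !mxE !exprS expr0 mulr1.
Qed.
End DiagonalCurvature2.

(* [K], [L] and [M] are the sectional curvatures of the [t r], [t theta] and
   [r theta] planes, up to sign; the mixed Ricci tensor is
   [- diag(K + L, K + M, L + M)]. *)
Definition curvature_values (R : realType) (g : metric R) (x : 'rV[R]_3)
    (K L M : R) : Prop :=
  [/\ scalarR g x = - 2 * (K + L + M),
      scalarS2 g x = 2 / 3 * (K ^+ 2 + L ^+ 2 + M ^+ 2 - K * L - K * M - L * M),
      scalarS3 g x =
        (2 * M - K - L) * (2 * L - K - M) * (2 * K - L - M) / 9 &
      densityY6 g x = - 2 * ((M - L) * (L - K) * (K - M)) ^+ 2].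

Lemma curvature_diag (R : realType) (F l : 'I_3 -> R -> R) (r : R)
    (dl : 'I_3 -> R) (x : 'rV[R]_3) :
  (forall i, \forall s \near r, F i s != 0) ->
  (forall i, \forall s \near r, is_derive s (1 : R) (F i) (2 * F i s * l i s)) ->
  (forall i, is_derive r (1 : R) (l i) (dl i)) -> x 0 1 = r ->
  curvature_values (diag_metric F) x (sectional01 F l r dl) (sectional02 F l r)
    (sectional12 F l r dl).
Proof.
move=> F0 dF dlP x1.
have S2 := scalarS2_diag F0 dF dlP x1; have S3 := scalarS3_diag F0 dF dlP x1.
rewrite sum_ord3 !mxE /= in S2; rewrite sum_ord3 !mxE /= in S3.
split; first exact: scalarR_diag.
- by rewrite S2; field.
- by rewrite S3; field.
- by rewrite /densityY6 S2 S3; field.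
Qed.

(** * Curvature of the static spherically symmetric ansatz *)

Lemma near_id_neq0 (R : realType) (r : R) : r != 0 -> \forall s \near r, s != 0.
Proof. by move=> r0; apply: (@near_neq0 R id r) => //; exact: derivable_id. Qed.

(** First derivatives must exist around [r] for the functions [l i] to be logarithmic derivatives
    there; the second derivative is used only at [r]. Both smooth functions and Taylor polynomials
    qualify. *)
Definition has_jet2 (R : realType) (u : R -> R) (r u0 u1 u2 : R) : Prop :=
  [/\ u r = u0, \forall s \near r, derivable u s 1, derive1 u r = u1 &
      is_derive r (1 : R) (derive1 u) u2].

(** The half logarithmic derivatives of the metric components are [N' / N + f' / (2 f)],
    [- f' / (2 f)] and [1 / r]. The last two curvatures differ by [f N' / (N r)] and so coincide
    when [n1 = 0]. *)
Lemma curvature_metricNf (R : realType) (N f : R -> R)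
    (r n0 n1 n2 f0 f1 f2 : R) :
  has_jet2 N r n0 n1 n2 -> has_jet2 f r f0 f1 f2 ->
  r != 0 -> n0 != 0 -> f0 != 0 ->
  curvature_values (metricNf N f) (radial_point r)
    (f0 * n2 / n0 + f2 / 2 + 3 / 2 * f1 * n1 / n0)
    (f1 / (2 * r) + f0 * n1 / (n0 * r)) (f1 / (2 * r)).
Proof.
move=> [<- dN <- dN1] [<- df <- df1] r0 Nr fr.
pose F (i : 'I_3) (s : R) := [:: - (N s ^+ 2 * f s); (f s)^-1; s ^+ 2]`_i.
pose l (i : 'I_3) (s : R) :=
  [:: derive1 N s / N s + derive1 f s / (2 * f s);
      - (derive1 f s / (2 * f s)); s^-1]`_i.
pose dl (i : 'I_3) := [:: n2 / N r - (derive1 N r / N r) ^+ 2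
    + f2 / (2 * f r) - derive1 f r ^+ 2 / (2 * f r ^+ 2);
  - (f2 / (2 * f r) - derive1 f r ^+ 2 / (2 * f r ^+ 2)); - r ^- 2]`_i.
have Nn : \forall s \near r, N s != 0 by apply: near_neq0 => //; exact: nbhs_singleton dN.
have fn : \forall s \near r, f s != 0 by apply: near_neq0 => //; exact: nbhs_singleton df.
have sn := near_id_neq0 r0.
have F0 i : \forall s \near r, F i s != 0.
  apply: filterS3 Nn fn sn => s Ns fs s0; move: i; apply: ord3_ind; rewrite /F /=.
  - by rewrite oppr_eq0 mulf_neq0 // expf_neq0.
  - by rewrite invr_eq0.
  - by rewrite expf_neq0.
have dF i : \forall s \near r, is_derive s (1 : R) (F i) (2 * F i s * l i s).
  have dd : \forall s \near r, derivable N s 1 /\ derivable f s 1.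
    by apply: filterS2 dN df => s.
  apply: filterS3 (filterI Nn fn) sn dd => s [Ns fs] s0 [dNs dfs].
  have eN := derivable_is_derive1 dNs; have ef := derivable_is_derive1 dfs.
  move: i; apply: ord3_ind; rewrite /F /l /=.
  - apply: is_derive1_eq; first by derive_tac.
    by rewrite /=; field; rewrite Ns fs.
  - apply: is_derive1_eq; first by derive_tac.
    by rewrite /=; field; rewrite fs.
  - apply: is_derive1_eq; first by derive_tac.
    by rewrite /=; field; rewrite s0.
have dlP i : is_derive r (1 : R) (l i) (dl i).
  have eN := derivable_is_derive1 (nbhs_singleton dN).
  have ef := derivable_is_derive1 (nbhs_singleton df).
  have f20 : 2 * f r != 0 by rewrite mulf_neq0 // pnatr_eq0.
  move: i; apply: ord3_ind; rewrite /l /dl /=.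
  - apply: is_derive1_eq; first by derive_tac.
    by rewrite /=; field; rewrite Nr fr.
  - apply: is_derive1_eq; first by derive_tac.
    by rewrite /=; field; rewrite fr.
  - apply: is_derive1_eq; first by derive_tac.
    by rewrite /=; field; rewrite r0.
have x1 : (radial_point r : 'rV[R]_3) 0 1 = r by rewrite mxE.
have := curvature_diag F0 dF dlP x1.
have -> : sectional01 F l r dl =
    f r * n2 / N r + f2 / 2 + 3 / 2 * derive1 f r * derive1 N r / N r.
  by rewrite /sectional01 /F /l /dl /=; field; rewrite Nr fr.
have -> : sectional02 F l r = derive1 f r / (2 * r) + f r * derive1 N r / (N r * r).
  by rewrite /sectional02 /F /l /dl /=; field; rewrite Nr fr r0.
have -> // : sectional12 F l r dl = derive1 f r / (2 * r).
by rewrite /sectional12 /F /l /dl /=; field; rewrite fr r0.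
Qed.

(** * Jets and the Euler-Lagrange operator *)

Lemma poly_infinite_roots (R : idomainType) (p : {poly R}) (t : nat -> R) :
  injective t -> (forall m, p.[t m] = 0) -> p = 0.
Proof.
move=> tI pt; apply/eqP; apply: contraT => p0.
have := @max_poly_roots _ p (map t (iota 0 (size p))) p0.
rewrite map_inj_uniq // iota_uniq size_map size_iota ltnn => -> //.
by apply/allP => _ /mapP[m _ ->]; rewrite rootE pt.
Qed.

(* The Euler-Lagrange equation along [f = s ^ k], as an identity in
   [tau = (k - 2) / (6 (k + 1))]; its coefficients determine D_(j+2) from
   D_(j+1) and D_j. *)
Lemma indicial_poly_eq0 (R : realFieldType) (n : nat) (D : {poly R}) :
  (0 < n)%N -> D`_1 = 0 ->
  (1 + (12 - 18 * n%:R)%:P * 'X) * (n%:R%:P * D - 'X * D^`())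
    - ((3^-1)%:P + (3 * n%:R - 5)%:P * 'X) * D^`() = 0 -> D = 0.
Proof.
move=> n0 D1 E.
have E' : n%:R *: D - 'X * D^`()
    + (12 - 18 * n%:R) *: ('X * (n%:R *: D - 'X * D^`()))
    - 3^-1 *: D^`() - (3 * n%:R - 5) *: ('X * D^`()) = 0.
  by rewrite -E -!mul_polyC; ring.
have cE j : n%:R * D`_j - (if j is i.+1 then i.+1%:R * D`_i.+1 else 0)
   + (12 - 18 * n%:R) * (if j is i.+1 then n%:R * D`_i - i%:R * D`_i else 0)
   - 3^-1 * (j.+1%:R * D`_j.+1)
   - (3 * n%:R - 5) * (if j is i.+1 then i.+1%:R * D`_i.+1 else 0) = 0.
  have := congr1 (fun p : {poly R} => p`_j) E'.
  rewrite coef0 !(coefB, coefD, coefZ) !coefXM !coef_deriv !mulr_natl.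
  case: j => [|j] /=.
    by rewrite !mulr0.
  by rewrite ?(coefB, coefZ, coefXM, coef_deriv) /=; case: j => [|j] /=;
    rewrite ?(coefB, coefZ, coefXM, coef_deriv) /= ?mulr_natl ?mul0r.
have nn : n%:R != 0 :> R by rewrite pnatr_eq0 -lt0n.
(* The constant coefficient of the equation reads n D_0 = D_1 / 3, so the missing D_1 forces D_0 = 0
   and starts the recurrence from two zeros. *)
have D0 : D`_0 = 0.
  have := cE 0%N; rewrite /= D1 !mulr0 !subr0 addr0 => /eqP.
  by rewrite mulf_eq0 (negbTE nn) => /eqP.
have step j : D`_j = 0 /\ D`_j.+1 = 0.
  elim: j => [|j [IH0 IH1]]; first by rewrite D0 D1.
  split => //; have := cE j.+1; rewrite IH0 IH1 !mulr0 !subr0 mulr0 addr0 sub0r.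
  move/eqP; rewrite oppr_eq0 !mulf_eq0 invr_eq0 !pnatr_eq0 /=.
  by move/eqP.
by apply/polyP => j; rewrite coef0 (step j).1.
Qed.

Lemma sum_nat3 (V : nmodType) (f : nat -> V) :
  \sum_(i < 3) f i = f 0%N + f 1%N + f 2%N.
Proof. by rewrite !big_ord_recl big_ord0 addr0 addrA. Qed.

Section Jets.
Variable R : realType.
Implicit Types (f u : R -> R) (r s : R) (y : nat -> R).

(** This lets the curvature formulas be applied to the Taylor polynomial inside [jet_function]. *)
Lemma taylor_jet2 r y :
  has_jet2 (fun s => \sum_(i < 3) y i * (s - r) ^+ i / i`!%:R) r (y 0%N) (y 1%N) (y 2%N).
Proof.
set u := (X in has_jet2 X).
have uE : u = fun s => y 0%N + y 1%N * (s - r) + y 2%N * (s - r) ^+ 2 / 2.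
  apply: funext => s; rewrite /u (sum_nat3 (fun i => y i * (s - r) ^+ i / i`!%:R)).
  have -> : (0`! = 1)%N by []. have -> : (1`! = 1)%N by []. have -> : (2`! = 2)%N by [].
  by rewrite expr0 expr1 mulr1 !divr1.
have du s : is_derive s (1 : R) u (y 1%N + y 2%N * (s - r)).
  rewrite uE; apply: is_derive1_eq; first by derive_tac.
  by rewrite /=; field.
have u1 : derive1 u = fun s => y 1%N + y 2%N * (s - r).
  by apply: funext => s; apply: is_derive_derive1.
split.
- by rewrite uE subrr expr0n /= !mulr0 mul0r !addr0.
- by apply: (@nearW _ (nbhs r)) => s; case: (du s).
- by rewrite u1 subrr mulr0 addr0.
- rewrite u1; apply: is_derive1_eq; first by derive_tac.
  by rewrite /=; ring.
Qed.

Lemma smooth_pos_near f r : smooth_pos f -> 0 < r -> f r != 0 ->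
  \forall s \near r, 0 < s /\ f s != 0.
Proof.
move=> sf r0 fr; have fn := near_neq0 (sf 0%N r r0) fr.
have sp : \forall s \near r, 0 < s by exact: lt_nbhsr.
by move: sp fn; apply: filterS2 => s.
Qed.

Lemma smooth_pos_jet2 f r : smooth_pos f -> 0 < r ->
  has_jet2 f r (f r) (derive1n 1 f r) (derive1n 2 f r).
Proof.
move=> sf r0; split; [exact: erefl| |exact: erefl|].
  have sp : \forall s \near r, 0 < s by exact: lt_nbhsr.
  by move: sp; apply: filterS => s s0; apply: (sf 0%N).
by apply: derivable_is_derive1; apply: (sf 1%N).
Qed.

Lemma cst_jet2 c r : has_jet2 (fun=> c) r c 0 0.
Proof.
split => //.
- by apply: (@nearW _ (nbhs r)) => s; exact: derivable_cst.
- exact: derive1_cst.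
- have -> : derive1 (fun=> c : R) = fun=> 0 by apply: funext => s; exact: derive1_cst.
  exact: is_derive_cst.
Qed.

(** At [N = 1] two of the three curvatures agree, and the traceless Ricci eigenvalues become [a],
    [a] and [- 2 a]. *)
Lemma curvature_metricf f r (f0 f1 f2 : R) : has_jet2 f r f0 f1 f2 -> r != 0 -> f0 != 0 ->
  let g := metricf f in let x := radial_point r in let a := (f1 / r - f2) / 6 in
  [/\ scalarR g x = - (f2 + 2 * f1 / r), scalarS2 g x = 6 * a ^+ 2,
      scalarS3 g x = - 6 * a ^+ 3 & densityY6 g x = 0].
Proof.
move=> jf r0 f00 g x a.
have [SR S2 S3 Y6] := curvature_metricNf (cst_jet2 1 r) jf r0 (oner_neq0 R) f00.
rewrite /g /metricf /a; split.
- by rewrite SR; field.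
- by rewrite S2; field.
- by rewrite S3; field.
- by rewrite Y6; field.
Qed.

(** Only the germs at [r] of the partial derivatives along [u] matter, so closed forms [G i] valid
    near [r] can replace them. *)
Lemma euler_lagrange2 (F : (R -> R) -> R -> R) u r (G : nat -> R -> R) :
  (forall i, (i < 3)%N -> \forall s \near r,
     derive1 (fun v => jet_function 2 F s
       (fun j => if j == i then v else derive1n j u s)) (derive1n i u s) = G i s) ->
  euler_lagrange 2 F u r =
    G 0%N r - derive1 (G 1%N) r + derive1 (derive1 (G 2%N)) r.
Proof.
move=> FG; rewrite /euler_lagrange.
pose E i s : R := derive1 (fun v => jet_function 2 F s
  (fun j => if j == i then v else derive1n j u s)) (derive1n i u s).
rewrite (sum_nat3 (fun i => (-1) ^+ i * derive1n i (E i) r)).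
rewrite (derive1n_near 0 (FG 0%N isT)) (derive1n_near 1 (FG 1%N isT)).
by rewrite (derive1n_near 2 (FG 2%N isT)) expr0 expr1 sqrrN expr1n !mul1r mulN1r.
Qed.

Lemma euler_lagrange2_eq0 (F : (R -> R) -> R -> R) u r :
  (forall i, (i < 3)%N -> \forall s \near r,
     derive1 (fun v => jet_function 2 F s
       (fun j => if j == i then v else derive1n j u s)) (derive1n i u s) = 0) ->
  euler_lagrange 2 F u r = 0.
Proof.
move=> F0; rewrite (euler_lagrange2 (G := fun _ _ => 0)) //.
have d0 : derive1 (fun=> 0 : R) = (fun=> 0 : R).
  by apply: funext => s; exact: derive1_cst.
by rewrite !d0 subr0 addr0.
Qed.

(** [Y_(6)] vanishes on every jet of [f] with nonzero value, so the reduced Lagrangian is locally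
    zero on jets and each of its partial derivatives is zero. *)
Lemma gqt_mulY6 (L : density R) : gqt (fun g x => densityY6 g x * L g x).
Proof.
move=> f r sf r0 fr; apply: euler_lagrange2_eq0 => i i3.
apply: filterS (smooth_pos_near sf r0 fr) => s [s0 fs].
rewrite -(derive1_cst (0 : R) (derive1n i f s)); apply: derive1_near.
(* Only varying the zeroth jet coordinate could make the value of [f] vanish, and not for [v] close
   to [f s]. *)
have v0 : \forall v \near derive1n i f s, (if 0%N == i then v else f s) != 0.
  case: i {i3} => [|i]; first exact: near_id_neq0.
  by apply: (@nearW _ (nbhs (derive1n i.+1 f s))) => v.
apply: filterS v0 => v v0; rewrite /jet_function /reduced_lagrangian.
pose y j := if j == i then v else derive1n j f s.
have [] := curvature_metricf (taylor_jet2 s y) (lt0r_neq0 s0) v0.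
by move=> _ _ _ ->; rewrite mul0r mulr0.
Qed.
End Jets.

(** * Triviality of the multiples of [Y_(6)] *)

Section Triviality.
Variable R : realType.
Implicit Types (f u : R -> R) (r s : R) (y : nat -> R) (L Q : density R).

(** Regularity of [P] is stated along derivable curves because one jet coordinate of [N] is varied
    at a time. *)
Definition smooth_invariant Q : Prop :=
  exists2 P : R -> R -> R -> R,
    forall g x, Q g x = P (scalarR g x) (scalarS2 g x) (scalarS3 g x) &
    forall (a b c : R -> R) (t : R),
      derivable a t 1 -> derivable b t 1 -> derivable c t 1 ->
      derivable (fun s => P (a s) (b s) (c s)) t 1.

Lemma derives_derivable f r (d : R) : derives r f d -> derivable f r 1.
Proof. by case. Qed.

Lemma derive1n_cst (c : R) n s : derive1n n.+1 (fun=> c) s = 0.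
Proof.
elim: n s => [|n IH] s; first exact: derive1_cst.
rewrite derive1nS; have -> : derive1n n.+1 (fun=> c) = fun=> 0 by apply: funext.
exact: derive1_cst.
Qed.

(* [Y_(6)] is [- 2] times the squared product of the differences of the
   eigenvalues of the Ricci tensor. One of them is [f N' / (N r)], so the first
   variation of [Y_(6)] at [N = 1] is zero. *)
Lemma trivial_mulY6 Q : smooth_invariant Q ->
  trivial_density (fun g x => densityY6 g x * Q g x).
Proof.
move=> [P QP dP] f r sf r0 fr; apply: euler_lagrange2_eq0 => i i3.
apply: filterS (smooth_pos_near sf r0 fr) => s [s0 fs].
have sn := lt0r_neq0 s0.
have jf := smooth_pos_jet2 sf s0.
set f1 := derive1n 1 f s in jf; set f2 := derive1n 2 f s in jf.
pose y (v : R) j := if j == i then v else derive1n j (fun=> 1 : R) s.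
pose N (v : R) := fun s' => \sum_(i < 3) y v i * (s' - s) ^+ i / i`!%:R.
have jN v : has_jet2 (N v) s (y v 0%N) (y v 1%N) (y v 2%N) by apply: taylor_jet2.
pose J (v : R) := action_lagrangian (fun g x => densityY6 g x * Q g x) f (N v) s.
change (derive1 J (derive1n i (fun=> 1 : R) s) = 0).
(* Unless [N'] itself is varied, the jet of [N] keeps [N' = 0]; two curvatures then coincide and
   [Y_(6)] stays zero. *)
have [i1|i1] := eqVneq i 1%N; last first.
  rewrite -(derive1_cst (0 : R) (derive1n i (fun=> 1 : R) s)); apply: derive1_near.
  have y0 : \forall v \near derive1n i (fun=> 1 : R) s, y v 0%N != 0.
    rewrite /y; case: i {y N jN J i3 i1} => [|i].
      exact: (near_id_neq0 (oner_neq0 R)).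
    apply: (@nearW _ (nbhs (derive1n i.+1 (fun=> 1 : R) s))) => v; exact: oner_neq0.
  apply: filterS y0 => v y0; rewrite /J /action_lagrangian.
  have [_ _ _ ->] := curvature_metricNf (jN v) jf sn y0 fs.
  have -> : y v 1%N = 0 by rewrite /y eq_sym (negbTE i1) derive1n_cst.
  by rewrite mulr0 mul0r addr0 subrr !mul0r expr0n /= mulr0 mul0r mulr0.
have y0 v : y v 0%N = 1 by rewrite /y i1.
have y1 v : y v 1%N = v by rewrite /y i1.
have y2 v : y v 2%N = 0 by rewrite /y i1; exact: (derive1n_cst 1 1).
pose K v := f2 / 2 + 3 / 2 * f1 * v.
pose L v := f1 / (2 * s) + f s / s * v.
pose M : R := f1 / (2 * s).
pose C := Num.sqrt `|\det (metricNf (fun=> 1) f (radial_point s))|.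
pose a v := - 2 * (K v + L v + M).
pose b v := 2 / 3 * (K v ^+ 2 + L v ^+ 2 + M ^+ 2 - K v * L v - K v * M - L v * M).
pose c v := (2 * M - K v - L v) * (2 * L v - K v - M) * (2 * K v - L v - M) / 9.
pose H v := C * - 2 * (f s / s) ^+ 2 * ((L v - K v) * (K v - M)) ^+ 2 * P (a v) (b v) (c v).
(* The squared difference [(M - L v) ^ 2] equals [(f s / s) ^ 2 * v ^ 2]. The double zero at
   [v = 0], times a function [H] derivable there, has zero derivative. *)
have JE : J = fun v => v * v * H v.
  apply: funext => v; rewrite /J /action_lagrangian QP.
  have Ns : N v s = 1 by have [-> _ _ _] := jN v.
  have -> : metricNf (N v) f (radial_point s) = metricNf (fun=> 1) f (radial_point s).
    by rewrite /metricNf mxE /= Ns.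
  have y0n : y v 0%N != 0 by rewrite y0 oner_neq0.
  have := curvature_metricNf (jN v) jf sn y0n fs.
  rewrite y0 y1 y2.
  have -> : f s * 0 / 1 + f2 / 2 + 3 / 2 * f1 * v / 1 = K v by rewrite /K; field.
  have -> : f1 / (2 * s) + f s * v / (1 * s) = L v by rewrite /L; field.
  rewrite -/M => -[-> -> -> ->]; rewrite -/(a v) -/(b v) -/(c v) -/C /H.
  have -> : M - L v = - (f s / s) * v by rewrite /M /L; ring.
  by ring.
have -> : derive1n i (fun=> 1 : R) s = 0 by rewrite i1 derive1n_cst.
have dK : derives 0 K (3 / 2 * f1).
  by apply: is_derive1_eq; [rewrite /K; derive_tac | rewrite /=; ring].
have dL : derives 0 L (f s / s).
  by apply: is_derive1_eq; [rewrite /L; derive_tac | rewrite /=; ring].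
have da : derivable a 0 1 by apply: derives_derivable; rewrite /a; derive_tac.
have db : derivable b 0 1 by apply: derives_derivable; rewrite /b; derive_tac.
have dc : derivable c 0 1 by apply: derives_derivable; rewrite /c; derive_tac.
have dPabc := derivable_is_derive1 (dP _ _ _ _ da db dc).
have dH : derivable H 0 1 by apply: derives_derivable; rewrite /H; derive_tac.
have dH1 := derivable_is_derive1 dH.
rewrite JE; apply: is_derive_derive1; apply: is_derive1_eq; first by derive_tac.
by rewrite /=; ring.
Qed.
End Triviality.

(** * The Euler-Lagrange equation tested on powers of the radius *)

Section PowerTest.
Variable R : realType.

Lemma derive1n_horner n (p : {poly R}) : derive1n n (horner p) = horner (derivn n p).
Proof.
elim: n p => [|n IH] p //.
by rewrite derive1Sn -derivE IH derivSn.
Qed.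

Lemma exprn_horner k : (fun s : R => s ^+ k) = horner 'X^k.
Proof. by apply: funext => s; rewrite hornerXn. Qed.

Lemma smooth_pos_expr k : smooth_pos (fun s : R => s ^+ k).
Proof.
by move=> n r _; rewrite exprn_horner derive1n_horner; apply: derivable_horner.
Qed.

Lemma derive1_expr k (c : R) :
  derive1 (fun s : R => c * s ^+ k) = fun s => c * k%:R * s ^+ k.-1.
Proof.
apply: funext => s; apply: is_derive_derive1; apply: is_derive1_eq; first by derive_tac.
by rewrite /=; ring.
Qed.

Section GQT.
Variables (n : nat) (d : nat -> R) (L : density R).
Hypothesis n2 : (2 <= n)%N.
Hypothesis d1 : d 1%N = 0.
Hypothesis LE : forall f (r f0 f1 f2 : R), has_jet2 f r f0 f1 f2 -> r != 0 -> f0 != 0 ->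
  L (metricf f) (radial_point r) = \sum_(p < n.+1) d p *
    ((- (f2 + 2 * f1 / r)) ^+ (n - p) * ((f1 / r - f2) / 6) ^+ p).
Hypothesis gqtL : gqt L.

Let D : {poly R} := \poly_(p < n.+1) d p.
(** [hR] and [ha] are the partial derivatives in [x] and in [a] of the form
    [\sum_p d p * x ^+ (n - p) * a ^+ p], hence homogeneous of degree [n - 1]. *)
Let hR (x a : R) := \sum_(p < n.+1) d p * ((n - p)%:R * x ^+ (n - p).-1 * a ^+ p).
Let ha (x a : R) := \sum_(p < n.+1) d p * (x ^+ (n - p) * (p%:R * a ^+ p.-1)).

(** Euler's identity for a form of degree [n], at [x = 1] and [a = t]. *)
Let hR1 t : hR 1 t = (n%:R%:P * D - 'X * D^`()).[t].
Proof.
rewrite !hornerE /hR; have -> : D = \sum_(p < n.+1) d p *: 'X^p by rewrite /D poly_def.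
rewrite raddf_sum /= !horner_sum !mulr_sumr -sumrB; apply: eq_bigr => p _.
rewrite derivZ derivXn !hornerE hornerMn hornerXn expr1n natrB; last by rewrite -ltnS.
rewrite ?mulr1; case: (p : nat) => [|q] /=; first by rewrite !expr0 mulr0n; ring.
by rewrite exprS -mulr_natl; ring.
Qed.

Let ha1 t : ha 1 t = D^`().[t].
Proof.
rewrite /ha; have -> : D = \sum_(p < n.+1) d p *: 'X^p by rewrite /D poly_def.
rewrite raddf_sum /= !horner_sum; apply: eq_bigr => p _.
by rewrite derivZ derivXn !hornerE hornerMn hornerXn expr1n -mulr_natl /=; ring.
Qed.

Let hR_scale c t : hR c (c * t) = c ^+ n.-1 * hR 1 t.
Proof.
rewrite /hR mulr_sumr; apply: eq_bigr => p _; rewrite expr1n exprMn.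
(* At [p = n] the exponent [(n - p).-1] is truncated to 0, but the factor [n - p] removes the
   term. *)
have [->|] := eqVneq (n - p)%N 0%N; first by rewrite !mul0r !mulr0.
rewrite -lt0n => np; have -> : n.-1 = ((n - p).-1 + p)%N.
  by lia.
by rewrite exprD; ring.
Qed.

Let ha_scale c t : ha c (c * t) = c ^+ n.-1 * ha 1 t.
Proof.
rewrite /ha mulr_sumr; apply: eq_bigr => p _; rewrite expr1n exprMn.
case: (p : nat) (ltn_ord p) => [|q] qn; first by rewrite !mul0r !mulr0.
have -> : n.-1 = ((n - q.+1) + q)%N.
  by lia.
by rewrite exprD /=; ring.
Qed.

Let jetL s y : s != 0 -> y 0%N != 0 ->
  jet_function 2 (reduced_lagrangian L) s y = s * \sum_(p < n.+1) d p *
    ((- (y 2%N + 2 * y 1%N / s)) ^+ (n - p) * ((y 1%N / s - y 2%N) / 6) ^+ p).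
Proof.
by move=> s0 y0; rewrite /jet_function /reduced_lagrangian (LE (taylor_jet2 s y)).
Qed.

Let dsum (x a : R -> R) (t x' a' : R) : derives t x x' -> derives t a a' ->
  derives t (fun v => \sum_(p < n.+1) d p * (x v ^+ (n - p) * a v ^+ p))
    (hR (x t) (a t) * x' + ha (x t) (a t) * a').
Proof.
move=> dx da; rewrite !mulr_suml -big_split /=.
apply: is_derive1_sum => p; apply: is_derive1_eq; first by derive_tac.
by rewrite /=; ring.
Qed.

(** On [f = s ^ k] both [R] and [a] are multiples of [s ^ (k - 2)] with constant ratio [a / R = t].
    By homogeneity every term of the equation carries the same power of [s], and evaluation at
    [s = 1] loses nothing. *)
Let along_power m : let k := m.+3 in let e := (m.+1 * n.-1)%N in
  let t := m.+1%:R / (6 * (m + 4)%:R) in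
  (1 - e%:R) * hR 1 t - (e + 2)%:R / 6 * ha 1 t = 0.
Proof.
move=> k e t.
pose f := fun s : R => s ^+ k.
have f1 : derive1n 1 f = fun s => k%:R * s ^+ m.+2.
  have := derive1_expr k 1; under eq_fun do rewrite mul1r.
  by under [in RHS]eq_fun do rewrite mul1r.
have f2 : derive1n 2 f = fun s => k%:R * m.+2%:R * s ^+ m.+1.
  by rewrite derive1nS f1 derive1_expr.
pose c := - ((m + 4)%:R * k%:R) : R.
have c0 : c != 0 by rewrite oppr_eq0 mulf_neq0 // pnatr_eq0 // addnS.
pose A := c ^+ n.-1 * hR 1 t; pose B := c ^+ n.-1 * ha 1 t.
have m4 : (m + 4)%:R != 0 :> R by rewrite pnatr_eq0 addnS.
have xE s : s != 0 -> - (k%:R * m.+2%:R * s ^+ m.+1 + 2 * (k%:R * s ^+ m.+2) / s) = c * s ^+ m.+1.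
  move=> s0; rewrite /c [s ^+ m.+2]exprSr /k natrD -[in m.+3%:R]natr1 -[in m.+2%:R]natr1 -natr1.
  by field.
have aE s : s != 0 -> (k%:R * s ^+ m.+2 / s - k%:R * m.+2%:R * s ^+ m.+1) / 6 = c * s ^+ m.+1 * t.
  move=> s0; rewrite /c /t [s ^+ m.+2]exprSr /k.
  have -> : m.+2%:R = m.+1%:R + 1 :> R by rewrite natr1.
  by field; rewrite -natrD m4 s0.
have hRE s : s != 0 -> hR (c * s ^+ m.+1) (c * s ^+ m.+1 * t) = A * s ^+ e.
  by move=> s0; rewrite hR_scale exprMn -exprM /A /e; ring.
have haE s : s != 0 -> ha (c * s ^+ m.+1) (c * s ^+ m.+1 * t) = B * s ^+ e.
  by move=> s0; rewrite ha_scale exprMn -exprM /B /e; ring.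
have fn1 : f 1 != 0 by rewrite /f expr1n oner_neq0.
have := gqtL (@smooth_pos_expr k) ltr01 fn1.
(* The reduced Lagrangian does not contain [f] itself, whence [G 0 = 0]; the other two follow by the
   chain rule from [R = - (f'' + 2 f' / s)] and [a = (f' / s - f'') / 6]. *)
pose G i (s : R) : R := if i is 0%N then 0 else if i is 1%N then (- 2 * A + B / 6) * s ^+ e
  else (- A - B / 6) * s ^+ e.+1.
rewrite (euler_lagrange2 (G := G)) => [|i i3].
  rewrite /G /= !derive1_expr.
  rewrite !expr1n => E.
  (* The equation is [c ^+ n.-1 * e] times the claim; [e] is nonzero because [n >= 2]. *)
  have e0 : e%:R != 0 :> R.
    by rewrite pnatr_eq0 muln_eq0 /= -lt0n -subn1 subn_gt0.
  have cn : c ^+ n.-1 != 0 by rewrite expf_neq0.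
  apply: (mulfI (mulf_neq0 cn e0)); rewrite mulr0 -[RHS]E /A /B natrD -[in e.+1%:R]natr1.
  by field.
apply: filterS (smooth_pos_near (@smooth_pos_expr k) ltr01 fn1) => s [s0 fs].
have sn := lt0r_neq0 s0.
have E1 : derive1n 1 f s = k%:R * s ^+ m.+2 by rewrite f1.
have E2 : derive1n 2 f s = k%:R * m.+2%:R * s ^+ m.+1 by rewrite f2.
pose u1 := k%:R * s ^+ m.+2 : R; pose u2 := k%:R * m.+2%:R * s ^+ m.+1 : R.
pose ell (v w : R) := s * \sum_(p < n.+1) d p *
  ((- (w + 2 * v / s)) ^+ (n - p) * ((v / s - w) / 6) ^+ p).
have ellE (y : nat -> R) : y 0%N != 0 ->
    jet_function 2 (reduced_lagrangian L) s y = ell (y 1%N) (y 2%N).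
  by move=> y0; rewrite jetL.
rewrite -/f; case: i i3 => [|[|[|//]]] _; rewrite /G.
- rewrite -(derive1_cst (ell u1 u2) (derive1n 0 f s)).
  apply: derive1_near; apply: filterS (near_id_neq0 fs) => v v0.
  by rewrite ellE // /u1 /u2 -E1 -E2.
- rewrite (_ : (fun v => _) = ell ^~ u2) ?E1; last first.
    by apply: funext => v; rewrite ellE // /u2 -E2.
  apply: is_derive_derive1; apply: is_derive1_eq.
    apply: is_derive1M; first by derive_tac.
    by apply: dsum; derive_tac.
  rewrite /u2 /= xE // aE // hRE // haE //.
  by field.
- rewrite (_ : (fun v => _) = ell u1) ?E2; last first.
    by apply: funext => v; rewrite ellE // /u1 -E1.
  apply: is_derive_derive1; apply: is_derive1_eq.
    apply: is_derive1M; first by derive_tac.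
    by apply: dsum; derive_tac.
  rewrite /u1 /= xE // aE // hRE // haE // [s ^+ e.+1]exprS.
  by field.
Qed.

Lemma gqt_coef_eq0 p : (p <= n)%N -> d p = 0.
Proof.
move=> pn; suff D0 : D = 0.
  by have := coef_poly n.+1 d p; rewrite -/D D0 coef0 ltnS pn.
apply: (@indicial_poly_eq0 _ n) => //.
- exact: ltnW.
- by rewrite /D coef_poly d1 if_same.
pose t m : R := m.+1%:R / (6 * (m + 4)%:R).
have m4 m : (m + 4)%:R != 0 :> R by rewrite pnatr_eq0 addnS.
apply: (@poly_infinite_roots _ _ t) => [m m' /eqP|m].
  rewrite eqr_div ?mulf_neq0 ?m4 ?pnatr_eq0 // -!natrM eqr_nat => /eqP; lia.
have := along_power m; rewrite /= hR1 ha1 -/(t m) !hornerE.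
set u := D^`().[t m]; set w := D.[t m] => E.
(* Since [3 / (m + 4) = 1 - 6 * t m], this factor turns coefficients affine in [m] into coefficients
   affine in [t m], which gives the polynomial identity at [t m]. *)
have := congr1 (fun z => 3 / (m + 4)%:R * z) E; rewrite mulr0 => <-.
have n1 : n.-1%:R = n%:R - 1 :> R by rewrite -subn1 natrB // ltnW.
have m1 : m.+1%:R = m%:R + 1 :> R by rewrite natr1.
have e1 : (m.+1 * n.-1)%:R = (m%:R + 1) * (n%:R - 1) :> R by rewrite natrM n1 m1.
rewrite /t [in (_ + 2)%:R]natrD e1 m1 /=.
by field; rewrite -natrD m4.
Qed.
End GQT.
End PowerTest.

(** * Spans of densities and the normal form *)

Section Spans.
Variable R : realType.
Implicit Types (A B : set (density R)) (L M : density R).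

Lemma lspan0 A : lspan A (fun _ _ => 0).
Proof.
exists 0%N, (fun=> 0), (fun _ _ _ => 0); split; first by case.
by apply: funext => g; apply: funext => x; rewrite big_ord0.
Qed.

Lemma lspan_cons A (c : R) M L : A M -> lspan A L ->
  lspan A (fun g x => c * M g x + L g x).
Proof.
move=> AM [k [d [e [Ae ->]]]].
exists k.+1, (fun i => if unlift ord0 i is Some j then d j else c),
  (fun i => if unlift ord0 i is Some j then e j else M); split.
  by move=> i; case: unliftP.
apply: funext => g; apply: funext => x; rewrite big_ord_recl unlift_none.
by congr (_ + _); apply: eq_bigr => i _; rewrite liftK.
Qed.

Lemma lspan_ind A (P : density R -> Prop) : P (fun _ _ => 0) ->
  (forall c M L, A M -> P L -> P (fun g x => c * M g x + L g x)) ->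
  forall L, lspan A L -> P L.
Proof.
move=> P0 Pc L [k [d [e [Ae ->]]]].
elim: k d e Ae => [|k IH] d e Ae.
  have -> // : (fun g x => \sum_(i < 0) d i * e i g x) = (fun _ _ => 0 : R).
  by apply: funext => g; apply: funext => x; rewrite big_ord0.
have -> : (fun g x => \sum_i d i * e i g x) = (fun g x => d ord0 * e ord0 g x +
    \sum_i d (lift ord0 i) * e (lift ord0 i) g x).
  by apply: funext => g; apply: funext => x; rewrite big_ord_recl.
by apply: Pc => //; apply: IH => i.
Qed.

Lemma lspan_mem A M : A M -> lspan A M.
Proof.
move=> AM; have := lspan_cons 1 AM (lspan0 A); congr lspan.
by apply: funext => g; apply: funext => x; rewrite mul1r addr0.
Qed.

Lemma lspan_eq A L M : lspan A L -> (forall g x, L g x = M g x) -> lspan A M.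
Proof. by move=> AL LM; have <- : L = M by apply: funext => g; apply: funext => x. Qed.

Lemma lspanD A L M : lspan A L -> lspan A M -> lspan A (fun g x => L g x + M g x).
Proof.
move=> AL AM; move: L AL; apply: lspan_ind => [|c K L AK IH].
  by apply: (lspan_eq AM) => g x; rewrite add0r.
by apply: (lspan_eq (lspan_cons c AK IH)) => g x; rewrite addrA.
Qed.

Lemma lspanZ A c L : lspan A L -> lspan A (fun g x => c * L g x).
Proof.
move: L; apply: lspan_ind => [|d K L AK IH].
  by apply: (lspan_eq (lspan0 A)) => g x; rewrite mulr0.
by apply: (lspan_eq (lspan_cons (c * d) AK IH)) => g x; rewrite mulrDr mulrA.
Qed.

Lemma lspan_sub A B : A `<=` lspan B -> lspan A `<=` lspan B.
Proof.
move=> AB; apply: lspan_ind => [|c M L AM BL]; first exact: lspan0.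
by apply: lspanD BL; apply: lspanZ; apply: AB.
Qed.

Lemma lspan_seqP (T : eqType) (s : seq T) (e : T -> density R) L : uniq s ->
  lspan [set e t | t in [set` s]] L ->
  exists c : T -> R, L = fun g x => \sum_(t <- s) c t * e t g x.
Proof.
move=> us; move: L; apply: lspan_ind => [|c _ L [t /= ts <-] [d ->]].
  exists (fun=> 0); apply: funext => g; apply: funext => x.
  by rewrite big1 // => t _; rewrite mul0r.
exists (fun t' => (if t' == t then c else 0) + d t').
apply: funext => g; apply: funext => x.
under [RHS]eq_bigr do rewrite mulrDl; rewrite big_split /=; congr (_ + _).
rewrite (bigD1_seq t) //= eqxx big1 ?addr0 // => t' /negbTE ->.
by rewrite mul0r.
Qed.

Lemma lspan_seq (T : eqType) (s : seq T) (e : T -> density R) (c : T -> R) :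
  lspan [set e t | t in [set` s]] (fun g x => \sum_(t <- s) c t * e t g x).
Proof.
(* The list summed over is separated from the list of generators, so that the induction shortens
   only the former. *)
have : {subset s <= s} by [].
move: {1 4}s => s'; elim: s' => [|t s' IH] ss'.
  by apply: (lspan_eq (lspan0 _)) => g x; rewrite big_nil.
have et : [set e t | t in [set` s]] (e t).
  by exists t => //=; apply: ss'; rewrite mem_head.
have /IH/(lspan_cons (c t) et) : {subset s' <= s}.
  by move=> u us; apply: ss'; rewrite inE us orbT.
by congr lspan; apply: funext => g; apply: funext => x; rewrite big_cons.
Qed.

Lemma independent_number_seq (T : eqType) (s : seq T) (e : T -> density R) :
  uniq s ->
  (forall c : T -> R,
     (forall g x, lorentzian_near g x -> \sum_(t <- s) c t * e t g x = 0) ->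
     {in s, forall t, c t = 0}) ->
  independent_number (lspan [set e t | t in [set` s]]) (size s).
Proof.
move=> us ind; exists (fun i => e (tnth (in_tuple s) i)); split.
  congr lspan; apply/seteqP; split => [_ [t /= ts <-]|_ [i _ <-]].
    by have /tnthP[i ->] : t \in in_tuple s by []; exists i.
  by exists (tnth (in_tuple s) i) => //=; apply: mem_tnth.
move=> c c0 i.
(* Coefficients indexed by positions are transferred to elements; as [s] has no repetition, each sum
   has a single term for [t] in [s]. *)
pose d t := \sum_(j < size s | tnth (in_tuple s) j == t) c j.
have tI : injective (tnth (in_tuple s)) by apply/tuple_uniqP.
have dE j : d (tnth (in_tuple s) j) = c j.
  rewrite /d (bigD1 j) //= big1 ?addr0 // => k /andP[/eqP/tI ->].
  by rewrite eqxx.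
rewrite -dE; apply: ind => [g x gx|]; last exact: mem_tnth.
rewrite big_tnth -[RHS](c0 g x gx); apply: eq_bigr => j _.
by rewrite dE.
Qed.
End Spans.

Section NormalForm.
Variable R : realType.
Implicit Types (L M : density R) (n p q : nat).

(* [weight_part p y z] is the monomial [y ^ j * z ^ e] with [2 j + 3 e = p] and
   [e <= 1]; there is none for [p = 1]. *)
Definition weight_part (A : comNzRingType) p (y z : A) : A :=
  if odd p then y ^+ (p - 3)./2 * z else y ^+ p./2.

Definition normal_form n (qp : nat * nat) : density R := fun g x =>
  densityY6 g x ^+ qp.1 * scalarR g x ^+ (n - 6 * qp.1 - qp.2) *
  weight_part qp.2 (scalarS2 g x) (scalarS3 g x).

Definition normal_index n : seq (nat * nat) :=
  [seq qp <- [seq (q, p) | q <- iota 0 n.+1, p <- iota 0 n.+1] |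
     (6 * qp.1 + qp.2 <= n)%N && (qp.2 != 1%N)].

Definition normal_span n := lspan [set normal_form n qp | qp in [set` normal_index n]].

Lemma mem_normal_index n q p :
  ((q, p) \in normal_index n) = (6 * q + p <= n)%N && (p != 1%N).
Proof.
rewrite mem_filter; apply: andb_idr => /andP[qp _]; rewrite [_.1]/= [_.2]/= in qp.
by apply/allpairsP; exists (q, p); rewrite !mem_iota /=; split => //; lia.
Qed.

Lemma normal_index_uniq n : uniq (normal_index n).
Proof. by apply/filter_uniq/allpairs_uniq => [||[? ?] [? ?] _ _ //]; apply: iota_uniq. Qed.

Lemma sum_normal_index (V : nmodType) n (F : nat * nat -> V) :
  \sum_(qp <- normal_index n) F qp = \sum_(q < n.+1)
    \sum_(p < n.+1 | (6 * q + p <= n)%N && ((p : nat) != 1%N)) F (q : nat, p : nat).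
Proof.
rewrite big_filter big_mkcond big_allpairs.
rewrite -[iota 0 n.+1]/(index_iota 0 n.+1) big_mkord; apply: eq_bigr => q _.
by rewrite big_mkord [RHS]big_mkcond.
Qed.

Definition monomial i j k : density R :=
  fun g x => scalarR g x ^+ i * scalarS2 g x ^+ j * scalarS3 g x ^+ k.

Lemma order_monomial i j k n : (i + 2 * j + 3 * k)%N = n ->
  order_densities n%:Z (monomial i j k).
Proof. by move=> <-; apply: lspan_mem; exists i, j, k. Qed.

Lemma order_densityM m n L M :
  order_densities m%:Z L -> order_densities n%:Z M ->
  order_densities (m + n)%N%:Z (fun g x => L g x * M g x).
Proof.
move=> mL nM; move: L mL; apply: lspan_ind => [|c K L [i [j [k [[E] ->]]]] IH].
  by apply: (lspan_eq (lspan0 _)) => g x; rewrite mul0r.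
suff KM : order_densities (m + n)%N%:Z (fun g x => monomial i j k g x * M g x).
  by apply: (lspan_eq (lspanD (lspanZ c KM) IH)) => g x; rewrite mulrDl mulrA.
move: M nM {L IH}; apply: lspan_ind => [|d K' L [i' [j' [k' [[E'] ->]]]] IH].
  by apply: (lspan_eq (lspan0 _)) => g x; rewrite mulr0.
have Emn : (i + i' + 2 * (j + j') + 3 * (k + k') = m + n)%N by lia.
by apply: (lspan_eq (lspanD (lspanZ d (order_monomial Emn)) IH)) => g x;
  rewrite /monomial !exprD; ring.
Qed.

Lemma order_densityX m L k : order_densities m%:Z L ->
  order_densities (m * k)%N%:Z (fun g x => L g x ^+ k).
Proof.
move=> mL; elim: k => [|k IH].
  by apply: (lspan_eq (@order_monomial 0 0 0 (m * 0) _)) => [|g x];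
    rewrite ?muln0 // /monomial !expr0 !mulr1.
by rewrite mulnS; apply: (lspan_eq (order_densityM mL IH)) => g x; rewrite -exprS.
Qed.

Lemma order_Y6 : order_densities 6%:Z (@densityY6 R).
Proof.
have S3 := @order_monomial 0 0 2 6 erefl; have S2 := @order_monomial 0 3 0 6 erefl.
apply: (lspan_eq (lspanD (lspanZ 6 S3) (lspanZ (-1) S2))) => g x.
by rewrite /monomial /densityY6 !expr0 !mul1r !mulr1 mulN1r.
Qed.

Lemma order_weight_part p : p != 1%N -> order_densities p%:Z
  (fun g x => weight_part p (scalarS2 g x) (scalarS3 g x) : R).
Proof.
move=> p1; rewrite /weight_part; case op: (odd p).
  have E : (0 + 2 * (p - 3)./2 + 3 * 1 = p)%N by lia.
  by apply: (lspan_eq (order_monomial E)) => g x; rewrite /monomial expr0 expr1 mul1r.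
have E : (0 + 2 * p./2 + 3 * 0 = p)%N by lia.
by apply: (lspan_eq (order_monomial E)) => g x; rewrite /monomial !expr0 mul1r mulr1.
Qed.

Lemma normal_span_mulY6 n L : normal_span n L ->
  normal_span (n + 6) (fun g x => densityY6 g x * L g x).
Proof.
move: L; apply: lspan_ind => [|c M L [[q p] /=]].
  by apply: (lspan_eq (lspan0 _)) => g x; rewrite mulr0.
rewrite mem_normal_index => /andP[qp p1] <- IH.
have mem : [set normal_form (n + 6) qp | qp in [set` normal_index (n + 6)]]
    (normal_form (n + 6) (q.+1, p)).
  by exists (q.+1, p) => //=; rewrite mem_normal_index p1 andbT; lia.
apply: (lspan_eq (lspan_cons c mem IH)) => g x.
rewrite /normal_form /= exprS; have -> : (n + 6 - 6 * q.+1 - p = n - 6 * q - p)%N by lia.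
by ring.
Qed.

(* [S_3 ^ 2 = (Y_(6) + S_2 ^ 3) / 6] lowers the exponent of [S_3]. *)
Lemma monomial_normal_span i j k n : (i + 2 * j + 3 * k)%N = n ->
  normal_span n (monomial i j k).
Proof.
elim/ltn_ind: k i j n => -[|[|k]] IH i j n E.
- apply: lspan_mem; exists (0%N, (2 * j)%N); first by rewrite /= mem_normal_index; lia.
  apply: funext => g; apply: funext => x; rewrite /normal_form /monomial /weight_part /=.
  have -> : odd (2 * j) = false by lia.
  have -> : ((2 * j)./2 = j)%N by lia.
  have -> : (n - 6 * 0 - 2 * j = i)%N by lia.
  by rewrite !expr0 mul1r mulr1.
- apply: lspan_mem; exists (0%N, (2 * j + 3)%N); first by rewrite /= mem_normal_index; lia.
  apply: funext => g; apply: funext => x; rewrite /normal_form /monomial /weight_part /=.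
  have -> : odd (2 * j + 3) = true by lia.
  have -> : ((2 * j + 3 - 3)./2 = j)%N by lia.
  have -> : (n - 6 * 0 - (2 * j + 3) = i)%N by lia.
  by rewrite expr0 expr1 mul1r mulrA.
have E1 : (i + 2 * j + 3 * k + 6 = n)%N by lia.
have E2 : (i + 2 * (j + 3) + 3 * k = n)%N by lia.
have H1 := normal_span_mulY6 (IH k _ i j _ erefl); rewrite E1 in H1.
have H2 := IH k _ i (j + 3)%N _ E2.
apply: (lspan_eq (lspanD (lspanZ 6^-1 (H1 _)) (lspanZ 6^-1 (H2 _)))) => // g x.
rewrite /monomial /densityY6.
by rewrite !exprSr !exprD; field.
Qed.

Lemma order_normal_span n : order_densities n%:Z = normal_span n.
Proof.
apply/seteqP; split.
  by apply: lspan_sub => _ [i [j [k [[E] ->]]]]; apply: monomial_normal_span.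
apply: lspan_sub => M [[q p] /=]; rewrite mem_normal_index => /andP[qp p1] <-.
have oY := order_densityX q order_Y6.
have oR := order_densityX (n - 6 * q - p) (@order_monomial 1 0 0 1 erefl).
have E : (6 * q + 1 * (n - 6 * q - p) + p = n)%N by lia.
have := order_densityM (order_densityM oY oR) (order_weight_part p1); rewrite E.
move/lspan_eq; apply => g x.
by rewrite /normal_form /monomial !expr0 expr1 !mulr1.
Qed.
End NormalForm.

(** * Linear independence *)

Section TestMetrics.
Variables (R : realType) (P Q : 'I_3 -> {poly R}).

Let F i s := (P i).[s] * expR (Q i).[s].

Lemma is_derive_horner (p : {poly R}) s : derives s (horner p) p^`().[s].
Proof. exact: is_derive_poly. Qed.

Lemma derive_poly_expR (p q : {poly R}) s :
  derives s (fun s => p.[s] * expR q.[s]) ((p^`() + p * q^`()).[s] * expR q.[s]).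
Proof.
have dp := is_derive_horner p s; have dq := is_derive_horner q s.
have de : derives s (fun s => expR q.[s]) (q^`().[s] * expR q.[s]).
  by apply: is_derive1_eq; [exact: (is_derive1_comp (f := expR)) | rewrite mulrC].
apply: is_derive1_eq; first by derive_tac.
by rewrite /= hornerD hornerM; ring.
Qed.

(** Functions of the form [p * exp q] with [p], [q] polynomials are stable under differentiation, so
    every iterated partial derivative keeps this form. *)
Lemma smooth_diag_metric a b (s : seq 'I_3) (y : 'rV[R]_3) :
  differentiable (foldr (@partial R) (fun z => diag_metric F z a b) s) y.
Proof.
suff [p [q ->]] : exists p q : {poly R},
    foldr (@partial R) (fun z => diag_metric F z a b) s =
    fun z => p.[z 0 1] * expR q.[z 0 1].
  apply: (@differentiable_comp _ _ _ _ (fun z : 'rV[R]_3 => z 0 1)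
            (fun s => p.[s] * expR q.[s])); first exact: differentiable_coord.
  by apply/derivable1_diffP; apply: derives_derivable; apply: derive_poly_expR.
elim: s => [|i s [p [q IH]]].
  have [ab|ab] := eqVneq a b.
    exists (P a), (Q a); apply: funext => z.
    by rewrite /= /diag_metric !mxE ab eqxx mulr1n.
  exists 0, 0; apply: funext => z.
  by rewrite /= /diag_metric !mxE (negbTE ab) mulr0n horner0 mul0r.
exists (if (i : nat) == 1%N then p^`() + p * q^`() else 0), q.
apply: funext => z; rewrite /= IH (partial_radial i (fun s => p.[s] * expR q.[s])).
case: ifP => _; last by rewrite horner0 mul0r.
by apply: is_derive_derive1; apply: derive_poly_expR.
Qed.
End TestMetrics.

Lemma attain_curvature (R : realType) (a w : R) :
  exists g x, [/\ lorentzian_near g x, scalarR g x = 1,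
    scalarS2 g x = 6 * a ^+ 2 + 2 * w ^+ 2 &
    scalarS3 g x = - 6 * a ^+ 3 + 6 * a * w ^+ 2].
Proof.
(* The sum [K + L + M] is [- 1 / 2], which gives [R = 1]; the deviations from the mean [- 1 / 6] are
   the traceless eigenvalues [- 2 a], [a - w], [a + w]. *)
pose K : R := - 6^-1 - 2 * a; pose L := - 6^-1 + a - w; pose M := - 6^-1 + a + w.
pose P (i : 'I_3) : {poly R} := [:: -1; 1; 1]`_i.
(* At the origin [l 0 = L] and [l 2 = 1], with derivatives [K - L ^+ 2] and [M - 1]; the three
   curvatures there are then [K], [L] and [M]. *)
pose Q (i : 'I_3) : {poly R} :=
  [:: (2 * L)%:P * 'X + (K - L ^+ 2)%:P * 'X^2; 0; 2%:P * 'X + (M - 1)%:P * 'X^2]`_i.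
pose F i s := (P i).[s] * expR (Q i).[s].
pose l (i : 'I_3) s : R := [:: L + (K - L ^+ 2) * s; 0; 1 + (M - 1) * s]`_i.
pose dl (i : 'I_3) : R := [:: K - L ^+ 2; 0; M - 1]`_i.
exists (diag_metric F), 0.
have F0 i : \forall s \near (0 : R), F i s != 0.
  apply: (@nearW _ (nbhs (0 : R))) => s; apply: mulf_neq0; last by rewrite gt_eqF // expR_gt0.
  by move: i; apply: ord3_ind; rewrite /P /= !hornerE ?oppr_eq0 oner_neq0.
have dF i : \forall s \near (0 : R), is_derive s (1 : R) (F i) (2 * F i s * l i s).
  apply: (@nearW _ (nbhs (0 : R))) => s.
  apply: is_derive1_eq; first exact: derive_poly_expR.
  move: i; apply: ord3_ind; rewrite /F /P /Q /l /=.
  - by rewrite !poly.derivE !hornerE /=; ring.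
  - by rewrite !poly.derivE !hornerE /=; ring.
  - by rewrite !poly.derivE !hornerE /=; ring.
have dlP i : is_derive (0 : R) (1 : R) (l i) (dl i).
  by move: i; apply: ord3_ind; rewrite /l /dl /=; apply: is_derive1_eq;
    (derive_tac || rewrite /=; ring).
have x1 : (0 : 'rV[R]_3) 0 1 = 0 by rewrite mxE.
have F1 : F 1 0 = 1 by rewrite /F /P /Q /= !hornerE expR0.
have := curvature_diag F0 dF dlP x1.
have -> : sectional01 F l 0 dl = K by rewrite /sectional01 F1 /l /dl /=; field.
have -> : sectional02 F l 0 = L by rewrite /sectional02 F1 /l /=; field.
have -> : sectional12 F l 0 dl = M by rewrite /sectional12 F1 /l /dl /=; field.
move=> [SR S2 S3 _]; split.
- apply: (@nearW _ (nbhs (0 : 'rV[R]_3))) => y; split; last first.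
    by move=> i j s; exact: (smooth_diag_metric P Q).
  (* Rescaling each axis by [|F i| ^ (- 1 / 2)] leaves the signs [P], that is, the signature. *)
  pose h (i : 'I_3) := expR (- ((Q i).[y 0 1] / 2)).
  exists (diag_mx (\row_i h i)).
    rewrite unitmxE det_diag unitfE; apply/prodf_neq0 => i _.
    by rewrite mxE gt_eqF // expR_gt0.
  rewrite tr_diag_mx /diag_metric !mulmx_diag; congr diag_mx; apply/rowP => i.
  have hE : h i * h i * expR (Q i).[y 0 1] = 1.
    by rewrite /h -!expRD (_ : _ + _ + _ = 0) ?expR0 //; field.
  rewrite !mxE [LHS](_ : _ = (P i).[y 0 1]); last first.
    by rewrite /F -[RHS]mulr1 -hE; ring.
  by move: i {hE}; apply: ord3_ind; rewrite /P /= !hornerE.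
- by rewrite SR /K /L /M; field.
- by rewrite S2 /K /L /M; field.
- by rewrite S3 /K /L /M; field.
Qed.

Section Independence.
Variable R : realType.

Lemma weight_part_horner p (y z : {poly R}) t :
  (weight_part p y z).[t] = weight_part p y.[t] z.[t].
Proof. by rewrite /weight_part; case: ifP => _; rewrite ?hornerM !horner_exp. Qed.

Lemma weight_part_scale p (y z t : R) : p != 1%N ->
  weight_part p (y * t ^+ 2) (z * t ^+ 3) = t ^+ p * weight_part p y z.
Proof.
move=> p1; rewrite /weight_part; case: ifP => op; rewrite exprMn -exprM.
  have E : (p = 2 * (p - 3)./2 + 3)%N by lia.
  by rewrite [in t ^+ p]E exprD; ring.
have E : (p = 2 * p./2)%N by lia.
by rewrite [in t ^+ p]E; ring.
Qed.

Lemma weight_part_neq0 p : weight_part p 6 (- 6) != 0 :> R.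
Proof.
have n6 : 6 != 0 :> R by rewrite pnatr_eq0.
by rewrite /weight_part; case: ifP => _; rewrite ?mulf_neq0 ?expf_neq0 ?oppr_eq0.
Qed.

(* The invariants [S_2], [S_3] and [Y_(6)] of the traceless eigenvalues
   [a + w], [a - w], [- 2 a]. *)
Definition eig2 (A : comNzRingType) (a w : A) : A := 6%:R * a ^+ 2 + 2%:R * w ^+ 2.
Definition eig3 (A : comNzRingType) (a w : A) : A :=
  - 6%:R * a ^+ 3 + 6%:R * a * w ^+ 2.
Definition eig6 (A : comNzRingType) (a w : A) : A :=
  6%:R * eig3 a w ^+ 2 - eig2 a w ^+ 3.

Lemma eig2_horner (a t : R) : (eig2 a%:P 'X).[t] = eig2 a t.
Proof. by rewrite /eig2 -!polyC_natr !hornerE. Qed.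

Lemma eig3_horner (a t : R) : (eig3 a%:P 'X).[t] = eig3 a t.
Proof. by rewrite /eig3 -!polyC_natr !hornerE. Qed.

Lemma eig6_horner (a t : R) : (eig6 a%:P 'X).[t] = eig6 a t.
Proof.
by rewrite /eig6 -!polyC_natr hornerD hornerN hornerM hornerC !horner_exp eig2_horner eig3_horner.
Qed.

(** The eigenvalues differ by [2 w], [3 a + w] and [3 a - w]; this is [- 2] times their
    discriminant. *)
Lemma eig6E (a w : R) : eig6 a w = - 8 * (w * (9 * a ^+ 2 - w ^+ 2)) ^+ 2.
Proof. by rewrite /eig6 /eig3 /eig2; ring. Qed.

Lemma eig6_poly_neq0 (a : R) : eig6 a%:P 'X != 0.
Proof.
(* The evaluation point lies beyond all the roots [0] and [3 a], [- 3 a]. *)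
apply/eqP => /(congr1 (fun p : {poly R} => p.[3 * `|a| + 1])) /eqP.
rewrite eig6_horner horner0 eig6E; apply/negP.
have an := normr_ge0 a.
have w0 : 3 * `|a| + 1 != 0 by apply: lt0r_neq0; lra.
have d0 : 9 * a ^+ 2 - (3 * `|a| + 1) ^+ 2 != 0.
  rewrite -(real_normK (num_real a)).
  have -> : 9 * `|a| ^+ 2 - (3 * `|a| + 1) ^+ 2 = - (6 * `|a| + 1) by ring.
  by rewrite oppr_eq0; apply: lt0r_neq0; lra.
by rewrite !mulf_neq0 // ?oppr_eq0 ?pnatr_eq0.
Qed.

Lemma poly_fun_eq0 (p : {poly R}) : (forall t, p.[t] = 0) -> p = 0.
Proof.
move=> p0; apply: (@poly_infinite_roots _ p (fun m => m%:R)) => //.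
by move=> m m' /eqP; rewrite eqr_nat => /eqP.
Qed.

(* At [w = 0] only the terms free of [Y_(6)] survive, and they have distinct
   powers of [a]; once they vanish, a factor [Y_(6)] cancels. *)
Lemma normal_terms_free N M (c : nat -> nat -> R) :
  (forall a, \sum_(q < N) eig6 a%:P 'X ^+ q *
     \sum_(p < M | (p : nat) != 1%N)
       (c q p)%:P * weight_part p (eig2 a%:P 'X) (eig3 a%:P 'X) = 0 :> {poly R}) ->
  forall q p, (q < N)%N -> (p < M)%N -> p != 1%N -> c q p = 0.
Proof.
elim: N c => [|N IH] c c0 q p // qN pM p1.
have c00 p' : (p' < M)%N -> p' != 1%N -> c 0%N p' = 0.
  move=> pM' p1'.
  (* At [w = 0] the part of weight [p] is [a ^+ p] times the nonzero constant
     [weight_part p 6 (- 6)], so the surviving sum is this polynomial evaluated at [a]. *)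
  pose D : {poly R} := \poly_(j < M) if j == 1%N then 0 else c 0%N j * weight_part j 6 (- 6).
  suff D0 : D = 0.
    have := coef_poly M (fun j => if j == 1%N then 0 else c 0%N j * weight_part j 6 (- 6)) p'.
    rewrite -/D D0 coef0 pM' (negbTE p1') => /esym/eqP.
    by rewrite mulf_eq0 (negbTE (weight_part_neq0 p')) orbF => /eqP.
  apply: poly_fun_eq0 => a; have := congr1 (fun u : {poly R} => u.[0]) (c0 a).
  rewrite big_ord_recl hornerD expr0 mul1r horner0.
  have -> : (\sum_(i < N) eig6 a%:P 'X ^+ lift ord0 i * \sum_(p < M | (p : nat) != 1%N)
      (c (lift ord0 i) p)%:P * weight_part p (eig2 a%:P 'X) (eig3 a%:P 'X)).[0] = 0.
    rewrite horner_sum big1 // => i _.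
    rewrite hornerM horner_exp eig6_horner eig6E mul0r expr0n /= mulr0.
    by rewrite exprS !mul0r.
  rewrite addr0 => <-; rewrite horner_sum /D horner_poly [RHS]big_mkcond.
  apply: eq_bigr => j _; case: eqP => [->|/eqP j1] /=; first by rewrite mul0r.
  rewrite hornerM hornerC weight_part_horner eig2_horner eig3_horner.
  have -> : eig2 a 0 = 6 * a ^+ 2 by rewrite /eig2; ring.
  have -> : eig3 a 0 = - 6 * a ^+ 3 by rewrite /eig3; ring.
  by rewrite weight_part_scale //; ring.
case: q qN => [|q] qN; first exact: c00.
apply: (IH (fun q => c q.+1)) => // a; apply: (mulfI (eig6_poly_neq0 a)).
rewrite mulr0 -[RHS](c0 a) big_ord_recl.
rewrite [X in _ = _ * X + _]big1 ?mulr0 ?add0r.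
  by rewrite mulr_sumr; apply: eq_bigr => i _; rewrite mulrA -exprS.
by move=> j j1; rewrite c00 // mul0r.
Qed.

Lemma normal_form_free n (c : nat * nat -> R) :
  (forall g x, lorentzian_near g x ->
     \sum_(qp <- normal_index n) c qp * normal_form n qp g x = 0) ->
  {in normal_index n, forall qp, c qp = 0}.
Proof.
move=> c0 [q p]; rewrite mem_normal_index => /andP[qp p1].
(* Coefficients are extended by zero from the triangle [6 q + p <= n] to a full rectangle. *)
pose d q p := if (6 * q + p <= n)%N then c (q, p) else 0.
suff : d q p = 0 by rewrite /d qp.
apply: (@normal_terms_free n.+1 n.+1 d) => //; try by lia.
move=> a; apply: poly_fun_eq0 => w.
(* Normalizing [R = 1] loses no information, since [n] and [(q, p)] determine the power of [R]. *)
have [g [x [gx SR S2 S3]]] := attain_curvature a w.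
rewrite -[RHS](c0 g x gx) sum_normal_index horner_sum; apply: eq_bigr => i _.
rewrite hornerM horner_exp eig6_horner horner_sum mulr_sumr big_mkcond [RHS]big_mkcond.
apply: eq_bigr => j _ /=; have [j1|j1] := boolP ((j : nat) == 1%N).
  by rewrite andbF.
rewrite andbT hornerM hornerC weight_part_horner eig2_horner eig3_horner /d.
case: ifP => _; last by rewrite mul0r mulr0.
rewrite /normal_form /= SR expr1n mulr1 /densityY6 -/(eig2 a w) S2 S3.
by rewrite /eig6 /eig2 /eig3; ring.
Qed.
End Independence.

(** * Counting *)

Definition multiple_index n : seq (nat * nat) :=
  [seq qp <- normal_index n | (0 < qp.1)%N].

Lemma mem_multiple_index n q p :
  ((q, p) \in multiple_index n) = [&& (0 < q)%N, (6 * q + p <= n)%N & p != 1%N].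
Proof. by rewrite mem_filter mem_normal_index. Qed.

Lemma multiple_index_uniq n : uniq (multiple_index n).
Proof. exact/filter_uniq/normal_index_uniq. Qed.

(** The indices with [q = 0] are the [n + 1] values of [p] up to [n] with [p = 1] left out. *)
Lemma size_normal_index n : (0 < n)%N ->
  size (normal_index n) = (n + size (multiple_index n))%N.
Proof.
move=> n0; rewrite -(count_predC (fun qp => 0 < qp.1)%N (normal_index n)) addnC.
rewrite -!size_filter; congr (_ + _)%N.
have sz : size [seq (0%N, p) | p <- iota 0 n.+1 & p != 1%N] = n.
  rewrite size_map size_filter -[n in RHS]/(n.+1.-1) -[in RHS](size_iota 0 n.+1).
  rewrite -(count_predC (pred1 1%N) (iota 0 n.+1)) count_uniq_mem ?iota_uniq //.
  by rewrite mem_iota ltnS n0.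
rewrite -[RHS]sz; apply: perm_size; apply: uniq_perm.
- exact/filter_uniq/normal_index_uniq.
- by rewrite map_inj_uniq ?filter_uniq ?iota_uniq // => p p' [].
move=> [q p]; rewrite mem_filter mem_normal_index [X in X && _]/=.
apply/idP/mapP => [H|[p' + [-> ->]]].
  exists p; first by rewrite mem_filter mem_iota; lia.
  by congr pair; lia.
by rewrite mem_filter mem_iota; lia.
Qed.

(** Dividing by one factor [Y_(6)] shifts [q] by one and is a bijection of index sets. *)
Lemma size_multiple_index n : size (multiple_index (n + 6)) = size (normal_index n).
Proof.
rewrite -[RHS](size_map (fun qp => (qp.1.+1, qp.2))); apply: perm_size.
apply: uniq_perm; first exact: multiple_index_uniq.
  by rewrite map_inj_uniq ?normal_index_uniq // => -[q p] [q' p'] [-> ->].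
move=> [q p]; rewrite mem_multiple_index; apply/idP/mapP => [H|[[q' p'] + [-> ->]]].
  exists (q.-1, p); first by rewrite mem_normal_index; lia.
  by congr pair => /=; lia.
by rewrite mem_normal_index /=; lia.
Qed.

(** * The closed formula for the number of densities *)

Section Sharp.
Variable R : realType.

(** The sign and the cosine have periods dividing 6, while the quadratic part grows by
    [72 * (m + 6)]. *)
Lemma sharp_step (m : int) : @sharp R (m + 6) = sharp R m + (m + 6)%:~R.
Proof.
rewrite /sharp expfzDr ?oppr_eq0 ?oner_neq0 //.
have -> : (-1 : R) ^ (6 : int) = 1 by rewrite -[LHS]/((-1) ^+ 6); ring.
have -> : 2 * pi * (m + 6)%:~R / 3 = 2 * pi * m%:~R / 3 + pi *+ 2 + pi *+ 2 :> R.
  by rewrite rmorphD /= -[6%:~R]/(6%:R : R) mulr2n; field.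
rewrite !cosD2pi rmorphD /= -[6%:~R]/(6%:R : R).
by field.
Qed.

(** Tripling the angle gives [2 pi], so its cosine [c] satisfies [(c - 1) * (2 * c + 1) ^+ 2 = 0];
    injectivity of the cosine on [[0, pi]] excludes [c = 1]. *)
Lemma cos_2pi3 : cos (2 * pi / 3) = - 2^-1 :> R.
Proof.
pose x : R := 2 * pi / 3; pose c := cos x.
have c3 : 4 * c ^+ 3 - 3 * c = 1.
  have x3 : x + x + x = pi *+ 2 by rewrite /x mulr2n; field.
  have := cos2pi R; rewrite -x3 !cosD sinD -/c => E; rewrite -[RHS]E.
  have s2 : sin x * sin x = 1 - c ^+ 2 by rewrite -expr2 sin2cos2.
  have -> : (c * c - sin x * sin x) * c - (sin x * c + c * sin x) * sin x =
    c ^+ 3 - 3 * c * (sin x * sin x) by ring.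
  by rewrite s2; ring.
have p0 := pi_gt0 R.
have c1 : c != 1.
  apply/eqP; rewrite /c -[RHS]cos0 => /cos_inj; rewrite !in_itv /= lexx (ltW p0) => x0.
  have : x = 0 by apply: x0 => //; rewrite /x; lra.
  by rewrite /x; lra.
have : (c - 1) * (2 * c + 1) ^+ 2 = 0.
  have -> : (c - 1) * (2 * c + 1) ^+ 2 = 4 * c ^+ 3 - 3 * c - 1 by ring.
  by rewrite c3 subrr.
move/eqP; rewrite mulf_eq0 subr_eq0 (negbTE c1) expf_eq0 /= => /eqP c2.
by rewrite -/x -/c; lra.
Qed.

Lemma cos_thirds : [/\ cos (2 * pi * 1 / 3) = - 2^-1 :> R,
  cos (2 * pi * 2 / 3) = - 2^-1 :> R, cos (2 * pi * 3 / 3) = 1 :> R,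
  cos (2 * pi * 4 / 3) = - 2^-1 :> R & cos (2 * pi * 5 / 3) = - 2^-1 :> R].
Proof.
pose x : R := 2 * pi / 3.
have c1 : cos x = - 2^-1 by exact: cos_2pi3.
have c2 : cos (x + x) = - 2^-1.
  by rewrite -mulr2n cos_mulr2n c1; field.
split.
- by rewrite mulr1.
- by rewrite -[RHS]c2; congr cos; rewrite /x; field.
- by rewrite -[RHS](cos2pi R); congr cos; rewrite mulr2n; field.
- by rewrite -[RHS]c1 -[in RHS]cosD2pi; congr cos; rewrite /x mulr2n; field.
- by rewrite -[RHS]c2 -[in RHS]cosD2pi; congr cos; rewrite /x mulr2n; field.
Qed.

(** The count and the formula obey the same recurrence of step 6, so only [n < 6] has to be
    computed. *)
Lemma sharp_size n : (size (normal_index n))%:R = @sharp R n%:Z.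
Proof.
have [c1 c2 c3 c4 c5] := cos_thirds.
elim/ltn_ind: n => n IH; have [n6|n6] := ltnP n 6.
  have e0 : (-1 : R) ^+ 0 = 1 by []; have e1 : (-1 : R) ^+ 1 = -1 by [].
  have e2 : (-1 : R) ^+ 2 = 1 by rewrite sqrrN expr1n.
  have e3 : (-1 : R) ^+ 3 = -1 by rewrite exprS e2 mulr1.
  have e4 : (-1 : R) ^+ 4 = 1 by rewrite exprS e3 mulrNN mulr1.
  have e5 : (-1 : R) ^+ 5 = -1 by rewrite exprS e4 mulr1.
  rewrite /sharp -[(-1) ^ n%:Z]/((-1) ^+ n) -[n%:Z%:~R]/(n%:R : R).
  case: n n6 {IH} => [|[|[|[|[|[|//]]]]]] _.
  - by rewrite -[size _]/1%N e0 !mulr0 !mul0r cos0; field.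
  - by rewrite -[size _]/1%N e1 c1; field.
  - by rewrite -[size _]/2%N e2 c2; field.
  - by rewrite -[size _]/3%N e3 c3; field.
  - by rewrite -[size _]/4%N e4 c4; field.
  - by rewrite -[size _]/5%N e5 c5; field.
have -> : n = (n - 6 + 6)%N by rewrite subnK.
rewrite size_normal_index; last by lia.
rewrite size_multiple_index natrD IH; last by lia.
by rewrite PoszD sharp_step addrC.
Qed.

Lemma sharp_size_multiple n : (0 < n)%N ->
  (size (multiple_index n))%:R = @sharp R n%:Z - n%:R.
Proof. by move=> n0; rewrite -sharp_size size_normal_index // natrD; ring. Qed.
End Sharp.

(** * The generalized quasi-topological densities of order [n] *)

Section Characterization.
Variable R : realType.
Implicit Types (L M : density R).

Lemma order_smooth_invariant (m : int) L : order_densities m L -> smooth_invariant L.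
Proof.
move: L; apply: lspan_ind => [|c _ L [i [j [k [_ ->]]]] [P LP dP]].
  exists (fun _ _ _ => 0); first by move=> g x.
  by move=> *; exact: derivable_cst.
exists (fun x y z => c * (x ^+ i * y ^+ j * z ^+ k) + P x y z) => [g x|].
  by rewrite LP.
move=> a b d t da db dd; have dPabc := derivable_is_derive1 (dP _ _ _ _ da db dd).
have da1 := derivable_is_derive1 da; have db1 := derivable_is_derive1 db.
have dd1 := derivable_is_derive1 dd.
by apply: derives_derivable; derive_tac.
Qed.

Lemma Y6_multiples n :
  [set (fun g x => densityY6 g x * L g x) | L in @order_densities R (n%:Z - 6)] =
  lspan [set @normal_form R n qp | qp in [set` multiple_index n]].
Proof.
have E : (6 <= n)%N -> n%:Z - 6 = (n - 6)%N%:Z by move=> n6; rewrite -subzn.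
apply/seteqP; split => [_ [L oL <-]|].
  have [n6|n6] := leqP 6 n.
    rewrite E // order_normal_span in oL.
    move: L oL; apply: lspan_ind => [|c M L [[q p] /=]].
      by apply: (lspan_eq (lspan0 _)) => g x; rewrite mulr0.
    rewrite mem_normal_index => /andP[qp p1] <- IH.
    have mem : [set @normal_form R n qp | qp in [set` multiple_index n]]
        (@normal_form R n (q.+1, p)).
      by exists (q.+1, p) => //=; rewrite mem_multiple_index p1 andbT; lia.
    apply: (lspan_eq (lspan_cons c mem IH)) => g x.
    rewrite /normal_form /= exprS.
    have -> : (n - 6 * q.+1 - p = n - 6 - 6 * q - p)%N by lia.
    by ring.
  (* For [n < 6] the order [n - 6] is negative: there are no monomials, and only the zero density is
     left. *)
  move: L oL; apply: lspan_ind => [|c M L [i [j [k [EE _]]]]].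
    by apply: (lspan_eq (lspan0 _)) => g x; rewrite mulr0.
  by exfalso; lia.
apply: lspan_ind => [|c M L [[q p] /=]].
  exists (fun _ _ => 0); first exact: lspan0.
  by apply: funext => g; apply: funext => x; rewrite mulr0.
rewrite mem_multiple_index => /and3P[q0 qp p1] <- [L' oL' <-].
have n6 : (6 <= n)%N by lia.
exists (fun g x => c * @normal_form R (n - 6) (q.-1, p) g x + L' g x).
  apply: lspanD oL'; apply: lspanZ; rewrite -/(order_densities _) E // order_normal_span.
  by apply: lspan_mem; exists (q.-1, p) => //=; rewrite mem_normal_index p1 andbT; lia.
apply: funext => g; apply: funext => x; rewrite mulrDr /normal_form /=; congr (_ + _).
rewrite -[in RHS](prednK q0) exprS.
have -> : (n - 6 * q.-1.+1 - p = n - 6 - 6 * q.-1 - p)%N by lia.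
by ring.
Qed.

Lemma gqt_multiples n : (2 <= n)%N -> @gqt_densities R n%:Z =
  lspan [set @normal_form R n qp | qp in [set` multiple_index n]].
Proof.
move=> n2; apply/seteqP; split => [L [oL gL]|L nL]; last first.
  split.
    rewrite order_normal_span; apply: lspan_sub nL => M [[q p] /= qp <-].
    by apply: lspan_mem; exists (q, p) => //=; move: qp; rewrite mem_filter => /andP[].
  by move: nL; rewrite -Y6_multiples => -[Q _ <-]; apply: gqt_mulY6.
rewrite order_normal_span in oL.
have [c LE] := lspan_seqP (normal_index_uniq n) oL.
(* These are the coefficients of [L] on the ansatz as a form in [R] and [a]: terms with [q > 0]
   contain [Y_(6) = 0], and [S_2 = 6 a ^ 2], [S_3 = - 6 a ^ 3] give [a ^ p] times a constant. *)
pose d p := if p == 1%N then 0 else c (0%N, p) * weight_part p 6 (- 6) : R.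
have d0 p : (p <= n)%N -> d p = 0.
  apply: (@gqt_coef_eq0 R n d L n2) => // f r f0 f1 f2 jf r0 f00.
  have [SR S2 S3 Y6] := curvature_metricf jf r0 f00.
  rewrite LE sum_normal_index big_ord_recl /= [X in _ + X]big1 => [|q _].
    rewrite addr0 big_mkcond; apply: eq_bigr => p' _.
    rewrite -ltnS ltn_ord /= /d; case: eqP => [->|/eqP p1] /=; first by rewrite mul0r.
    rewrite /normal_form /= expr0 mul1r SR S2 S3 weight_part_scale //.
    by rewrite muln0 subn0; ring.
  rewrite big1 // => p' _; rewrite /normal_form /= Y6 exprS.
  by rewrite !mul0r mulr0.
rewrite LE; have -> : (fun g x => \sum_(t <- normal_index n) c t * @normal_form R n t g x) =
    (fun g x => \sum_(t <- multiple_index n) c t * @normal_form R n t g x).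
  apply: funext => g; apply: funext => x; rewrite [RHS]big_filter [RHS]big_mkcond.
  rewrite big_seq [RHS]big_seq; apply: eq_bigr => -[[|q] p] //=.
  rewrite mem_normal_index => /andP[pn p1].
  have /eqP := d0 p pn; rewrite /d (negbTE p1) mulf_eq0 (negbTE (weight_part_neq0 _ _)) orbF.
  by move/eqP => ->; rewrite mul0r.
exact: lspan_seq.
Qed.

Lemma order_independent_number n :
  independent_number (@order_densities R n%:Z) (size (normal_index n)).
Proof.
rewrite order_normal_span; apply: independent_number_seq; first exact: normal_index_uniq.
exact: normal_form_free.
Qed.

Lemma gqt_independent_number n : (2 <= n)%N ->
  independent_number (@gqt_densities R n%:Z) (size (multiple_index n)).
Proof.
move=> n2; rewrite gqt_multiples //.
apply: independent_number_seq => [|c c0 qp]; first exact: multiple_index_uniq.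
rewrite mem_filter => /andP[q0 qpn].
(* Extension of the coefficients by zero to the indices with [q = 0] reduces the claim to
   independence of the whole normal form. *)
suff /(_ qp qpn) : {in normal_index n, forall qp, (if (0 < qp.1)%N then c qp else 0) = 0}.
  by rewrite q0.
apply: normal_form_free => g x gx; rewrite -[RHS](c0 g x gx) [RHS]big_filter [RHS]big_mkcond.
by apply: eq_bigr => t _; case: ifP => // _; rewrite mul0r.
Qed.
End Characterization.

Unset Implicit Arguments.

Theorem mainTheorem15 (R : realType) (n : nat) (hn : (2 <= n)%N) :
  (* #(n) is the number of independent order-n densities *)
  (exists2 D : nat, independent_number (@order_densities R n%:Z) D
                  & D%:R = @sharp R n%:Z) /\
  (* there are #(n) - n = #(n - 6) generalized quasi-topological ones *)
  (exists2 d : nat, independent_number (@gqt_densities R n%:Z) d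
                  & d%:R = @sharp R n%:Z - n%:R) /\
  @sharp R n%:Z - n%:R = @sharp R (n%:Z - 6) /\
  (* Y_(6) vanishes on the single-function ansatz *)
  (forall (f : R -> R) (r : R), smooth_pos f -> 0 < r -> f r != 0 ->
     densityY6 (metricf f) (radial_point r) = 0) /\
  (* they are the products Y_(6) * L, L an arbitrary density of order n - 6 *)
  @gqt_densities R n%:Z =
    [set (fun g x => densityY6 g x * L g x)
      | L in @order_densities R (n%:Z - 6)] /\
  (* they are all trivial *)
  (forall L : density R, gqt_densities n%:Z L -> trivial_density L) /\
  ~ (exists L : density R, gqt_densities n%:Z L /\ ~ trivial_density L).
Proof.
have gqtE : @gqt_densities R n%:Z =
    [set (fun g x => densityY6 g x * L g x) | L in @order_densities R (n%:Z - 6)].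
  by rewrite gqt_multiples // Y6_multiples.
have triv (L : density R) : gqt_densities n%:Z L -> trivial_density L.
  by rewrite gqtE => -[Q oQ <-]; apply: trivial_mulY6;
    apply: order_smooth_invariant oQ.
split.
  exists (size (normal_index n)); first exact: order_independent_number.
  exact: sharp_size.
split.
  exists (size (multiple_index n)); first exact: gqt_independent_number.
  by apply: sharp_size_multiple; apply: ltnW.
split.
  (* The recurrence holds over the integers, so it also covers [n < 6], where [n - 6] is
     negative. *)
  have := sharp_step R (n%:Z - 6); rewrite subrK => ->.
  by rewrite -[n%:Z%:~R]/(n%:R : R) addrK.
split.
  move=> f r sf r0 fr.
  by have [] := curvature_metricf (smooth_pos_jet2 sf r0) (lt0r_neq0 r0) fr.
split; first exact: gqtE.
by split=> [|[L [gL nL]]]; [exact: triv | apply: nL; apply: triv].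
Qed.
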